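(* Let $u$ be the solution of the Cauchy problem $$(\partial_t^2+A+B\partial_t)u=0,\qquad u|_{t=0}=u_0,\quad \partial_t u|_{t=0}=u_1 .$$ Then there exists $C>0$ such that for any $u_0\in D(\sqrt A)$, $u_1\in H$ and $t>1$, $$\|u(t)-B^{-1/2}e^{-t\tilde A}B^{1/2}u_0-B^{-1/2}e^{-t\tilde A}B^{-1/2}u_1\|_H\leq C t^{-1}\left(\|u_0\|_H+\|\sqrt A u_0\|_H+\|u_1\|_H\right).$$
   Context: $H$ is a Hilbert space. $A$ is a densely defined self-adjoint operator on $H$ that is positive, $A>0$ (i.e. $(Au,u)_H>0$ for $0\neq u\in D(A)$). $B$ is a bounded self-adjoint operator on $H$ with $B\geq c\,\mathrm{Id}$ for some constant $c>0$. The operators $B^{1/2}$ and $B^{-1/2}$ are continuous on $D(A)$: they map $D(A)$ into $D(A)$ and there is a constant $C>0$ such that $\|AB^{1/2}u\|_H\le C(\|u\|_H+\|Au\|_H)$ and $\|AB^{-1/2}u\|_H\le C(\|u\|_H+\|Au\|_H)$ for all $u\in D(A)$. Put $\tilde A=B^{-1/2}AB^{-1/2}$, which is self-adjoint with domain $D(A)$; $e^{-t\tilde A}$ is defined by the spectral theorem. Meaning of solution: let $H_1$ be the Hilbert space completion of $D(A)$ for the norm $\|u\|_{H_1}=\|\sqrt A u\|_H$ (so $D(\sqrt A)$ embeds in $H_1$, and $A$ extends to a bounded operator from $H_1$ to its dual), and $\mathcal H_0=H_1\times H$. The operator $\mathcal A(u,v)=(v,-Au-Bv)$ on $\mathcal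 H_0$ with domain $\{(u,v)\in H_1\times H: Au\in H,\ v\in D(\sqrt A)\}$ generates a contraction semigroup $U(t)=e^{t\mathcal A}$ on $\mathcal H_0$, which maps $D(\sqrt A)\times H$ into itself. For $(u_0,u_1)\in D(\sqrt A)\times H$ the solution $u(t)\in D(\sqrt A)$ is the first component of $U(t)(u_0,u_1)$. *)

(* Defs.v *)
From HB Require Import structures.
From mathcomp Require Import all_boot all_order all_algebra sesquilinear.
From mathcomp Require Import complex.
From mathcomp Require Import all_classical all_reals all_analysis.

Set Implicit Arguments.
Unset Strict Implicit.
Unset Printing Implicit Defensive.

Import Order.TTheory GRing.Theory Num.Theory.
Import numFieldNormedType.Exports.

Local Open Scope classical_set_scope.
Local Open Scope ring_scope.
Local Open Scope complex_scope.

(* A complex Hilbert space is a complete normed module over R[i] whose norm    *)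
(* comes from an inner product, linear in its first argument. Norms take       *)
(* their (nonnegative real) values in R[i].                                    *)
Definition hilbert_norm (R : realType) (H : completeNormedModType R[i])
    (dot : {dot H for Num.conj}) : Prop :=
  forall u : H, `|u| ^+ 2 = dot u u.

(* The values of [app] outside [dom] are meaningless.                          *)
Record operator (V : Type) := Operator { dom : set V ; app :> V -> V }.

Definition everywhere (V : Type) (T : V -> V) : operator V := Operator setT T.

Section Operators.
Variables (R : realType) (H : completeNormedModType R[i]).
Variable dot : {dot H for Num.conj}.
Implicit Types (A S : operator H) (T : H -> H).

Definition linear_operator A : Prop :=
  dom A 0 /\
  forall (a : R[i]) (u v : H), dom A u -> dom A v ->
    dom A (a *: u + v) /\ A (a *: u + v) = a *: A u + A v.

Definition bounded_operator T : Prop :=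
  linear T /\ exists M : R, forall u : H, `|T u| <= M%:C * `|u|.

(* The right-hand side of the equivalence says that v is in the domain of the  *)
(* adjoint of A, with image w: A is equal to its adjoint, domains included.    *)
Definition self_adjoint A : Prop :=
  [/\ linear_operator A, dense (dom A) &
      forall v w : H, (dom A v /\ A v = w) <->
        (forall u : H, dom A u -> dot (A u) v = dot u w)].

Definition positive A : Prop :=
  forall u : H, dom A u -> u != 0 -> 0 < dot (A u) u.

Definition nonnegative A : Prop :=
  forall u : H, dom A u -> 0 <= dot (A u) u.

(* S is the unique nonnegative self-adjoint operator with S S = A, domains     *)
(* included.                                                                   *)
Definition is_sqrt A S : Prop :=
  [/\ self_adjoint S, nonnegative S,
      dom A = [set u | dom S u /\ dom S (S u)] &
      forall u : H, dom A u -> A u = S (S u)].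

Definition continuous_on_domain A T : Prop :=
  exists2 C : R, 0 < C &
    forall u : H, dom A u -> dom A (T u) /\
      `|A (T u)| <= C%:C * (`|u| + `|A u|).

(* T A T with the domain of A, which is its natural domain when T maps the     *)
(* domain of A onto itself.                                                    *)
Definition sandwich T A : operator H := Operator (dom A) (fun u => T (A (T u))).

Definition projection_valued_measure
    (E : set (measurableTypeR R) -> H -> H) : Prop :=
  [/\ forall X, measurable X -> linear (E X) /\
        forall u v : H, dot (E X u) v = dot u (E X v),
      forall X Y u, measurable X -> measurable Y ->
        E (X `&` Y) u = E X (E Y u),
      forall u, E set0 u = 0,
      forall u, E setT u = u &
      forall (F : (set (measurableTypeR R))^nat) u,
        (forall n, measurable (F n)) -> trivIset setT F ->
        series (fun n => E (F n) u) @ \oo --> E (\bigcup_n F n) u].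

(* The measure X |-> (E(X) u, u), equal to |E(X) u|^2 since E(X) is an         *)
(* orthogonal projection.                                                      *)
Definition spectral_mass (E : set (measurableTypeR R) -> H -> H) (u : H)
    (X : set (measurableTypeR R)) : \bar R :=
  (complex.Re (`|E X u| ^+ 2))%:E.

(* T is the integral of the real Borel function f against E, with its natural  *)
(* domain. On a complex space the quadratic form (T u, u) determines T.        *)
Definition spectral_integral (E : set (measurableTypeR R) -> H -> H)
    (f : R -> R) (T : operator H) : Prop :=
  [/\ linear_operator T,
      dom T = [set u | (\int[spectral_mass E u]_x ((f x) ^+ 2)%:E < +oo)%E] &
      forall u, dom T u ->
        dot (T u) u = (fine (\int[spectral_mass E u]_x (f x)%:E))%:C].

(* T = f(A) by the spectral theorem.                                           *)
Definition functional_calculus A (f : R -> R) (T : operator H) : Prop :=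
  exists E, [/\ projection_valued_measure E, spectral_integral E id A &
                spectral_integral E f T].

End Operators.

Section DampedWave.
Variables (R : realType) (H H1 : completeNormedModType R[i]).
Variables (dot : {dot H for Num.conj}) (dot1 : {dot H1 for Num.conj}).
Variables (A S : operator H) (B : H -> H) (j : H -> H1).

(* H1, together with j, is the completion of the domain of A for the norm      *)
(* |S u|, where S is the square root of A; j is the resulting embedding of the *)
(* domain of S. The values of j elsewhere are meaningless.                     *)
Definition energy_completion : Prop :=
  [/\ forall (a : R[i]) (u v : H), dom S u -> dom S v ->
        j (a *: u + v) = a *: j u + j v,
      forall u : H, dom S u -> `|j u| = `|S u| &
      dense (j @` dom A)].

(* The bounded extension of A from H1 to its (anti)dual maps u to the form     *)
(* dot1 u, since dot1 (j u) (j phi) = (S u, S phi) = (A u, phi) for u and phi  *)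
(* in the domain of A. It is in H, equal to f, when it is given on the dense   *)
(* subspace j(D(A)) by the inner product of H with f.                          *)
Definition extension_eq (u : H1) (f : H) : Prop :=
  forall phi : H, dom A phi -> dot1 u (j phi) = dot f phi.

(* The graph of (u, v) |-> (v, - A u - B v).                                   *)
Definition damped_wave_graph : set ((H1 * H) * (H1 * H)) :=
  [set zw | dom S zw.1.2 /\
     exists f : H, extension_eq zw.1.1 f /\ zw.2 = (j zw.1.2, - f - B zw.1.2)].

(* The library norm of H1 * H is the max norm, which is only equivalent to the *)
(* Hilbert norm; hence the explicit sum of squares for the contractions.       *)
Definition contraction_semigroup (U : R -> H1 * H -> H1 * H) : Prop :=
  [/\ forall t, 0 <= t -> linear (U t),
      forall z, U 0 z = z,
      forall s t z, 0 <= s -> 0 <= t -> U (s + t) z = U s (U t z),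
      forall z, U t z @[t --> 0^'+] --> z &
      forall t z, 0 <= t ->
        `|(U t z).1| ^+ 2 + `|(U t z).2| ^+ 2 <= `|z.1| ^+ 2 + `|z.2| ^+ 2].

Definition has_generator (U : R -> H1 * H -> H1 * H)
    (G : set ((H1 * H) * (H1 * H))) : Prop :=
  forall z w, G (z, w) <->
    (t^-1)%:C *: (U t z - z) @[t --> 0^'+] --> w.

Definition is_solution (U : R -> H1 * H -> H1 * H) (u0 u1 : H) (u : R -> H) :
    Prop :=
  forall t, 0 <= t -> dom S (u t) /\ j (u t) = (U t (j u0, u1)).1.

End DampedWave.

(* Main.v *)
Require Import Defs.
From HB Require Import structures.
From mathcomp Require Import all_boot all_order all_algebra sesquilinear.
From mathcomp Require Import complex.
From mathcomp Require Import all_classical all_reals all_analysis.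
From mathcomp Require Import measurable_realfun ring lra.

Set Implicit Arguments.
Unset Strict Implicit.
Unset Printing Implicit Defensive.

Import Order.TTheory GRing.Theory Num.Theory.
Import numFieldNormedType.Exports.

Local Open Scope classical_set_scope.
Local Open Scope ring_scope.
Local Open Scope complex_scope.

(* Everything happens in the underlying real Hilbert space. Two applications of
   the resolvent of the damped wave generator G write the data as
   (1 - G)^2 (a, b), so that u = h - 2 h' + h'' where h is a classical solution
   together with h'; no derivative of u itself is needed. Weighted energy estimates
   for h and h' give |h| <= C, |h'| <= C / t and make s^3 |h''(s)|^2 integrable.

   The heat flow enters by duality. If y solves the backward equation
   B y' = A y with final value y(t) = B^(-1/2) phi, that is
   y(s) = B^(-1/2) exp(-(t - s) A~) phi, then (B h, y)' = - (h'', y), which is used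
   on [t/2, t], whereas ((B h + h', y) - (h, y'))' = - (h, y''), which is used on
   [0, t/2], where |y''| <= C |phi| / t^2. Since B u(0) + u'(0) =
   B a + b + A (2 a - b), the boundary terms at 0 compare h(t) with the heat flow
   of the data of u, as exp(-t A~) A~ has norm O(1/t).

   Only finite sums of spectral slabs of A~ of width t^-2 are needed for
   phi, and on each slab A~ and its heat flow are scalar up to a small error. *)

(** * The underlying real Hilbert space *)

(** The estimate leaves no room for derivatives of u. For h that constraint is gone: h, h', h'' are
    all controlled by the data norm, and h' and h'' decay like 1/t and t^(-3/2), so u(t) may be
    replaced by h(t) up to O(1/t). On [t/2, t] the pointwise decay of h'' would only yield t^(-1/2).
    Cauchy-Schwarz with weight s^3 yields the square root of the integral of s^(-3), which is of
    order 1/t; this is why the energy weights have to reach t^3. There the bound on y'' degenerates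
    at s = t, so the derivatives stay on h. On [0, t/2] they go to y: t - s >= t/2 makes y'' of size
    t^(-2), which integrates to 1/t using only that h is bounded. With slabs of width t^(-2), the
    defect in the backward equation is O(t^(-2)) and integrates to O(1/t), and the heat flow is off
    by t * t^(-2). Slabs suit a functional calculus that is specified by quadratic forms: a form
    bound on a slab already yields the scalar approximation in norm. *)

Section RealNorm.
Variables (R : realType) (V : normedModType R[i]).
Implicit Types (u v w : V) (a : R).

Definition nr u : R := complex.Re `|u|.

Lemma nrE u : `|u| = (nr u)%:C.
Proof. by rewrite /nr RRe_real ?normr_real. Qed.

Lemma nr_ge0 u : 0 <= nr u.
Proof. by rewrite -ler0c -nrE. Qed.

Lemma nr0 : nr (0 : V) = 0.
Proof. by rewrite /nr normr0. Qed.

Lemma nrN u : nr (- u) = nr u.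
Proof. by rewrite /nr normrN. Qed.

Lemma nrBC u v : nr (u - v) = nr (v - u).
Proof. by rewrite /nr distrC. Qed.

Lemma nrD u v : nr (u + v) <= nr u + nr v.
Proof. by rewrite -lecR rmorphD /= -!nrE ler_normD. Qed.

Lemma nrB u v : nr (u - v) <= nr u + nr v.
Proof. by rewrite -[nr v]nrN nrD. Qed.

Lemma nrZ a u : nr (a%:C *: u) = `|a| * nr u.
Proof.
apply: complexI; rewrite rmorphM /= -!nrE normrZ; congr (_ * _).
by rewrite normc_def /= expr0n /= addr0 sqrtr_sqr.
Qed.

Lemma nr_eq0 u : nr u = 0 -> u = 0.
Proof. by move=> h; apply/eqP; rewrite -normr_eq0 nrE h. Qed.

(** Positive elements of [R[i]] are real, so real radii suffice. *)
Lemma cvg_nr (T : Type) (F : set_system T) {FF : Filter F} (f : T -> V) (l : V) :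
  f @ F --> l <-> forall e : R, 0 < e -> \forall x \near F, nr (f x - l) < e.
Proof.
split => [/cvgrPdist_lt h e e0|h].
  have /h : 0 < e%:C :> R[i] by rewrite -[0]/((0 : R)%:C) ltcR.
  by apply: filterS => x; rewrite nrE ltcR nrBC.
apply/cvgrPdist_lt => e e0.
have eE : e = (complex.Re e)%:C by rewrite RRe_real // gtr0_real.
have /h : 0 < complex.Re e by rewrite -ltcR -eE.
by apply: filterS => x; rewrite nrE eE ltcR nrBC.
Qed.

End RealNorm.

Section RealInnerProduct.
Variables (R : realType) (H : completeNormedModType R[i]).
Variable dot : {dot H for Num.conj}.
Hypothesis hH : hilbert_norm dot.
Implicit Types (u v w : H) (a b : R) (z : R[i]).

Definition re_dot u v : R := complex.Re (dot u v).
Local Notation ip := re_dot.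

Lemma dotC u v : dot u v = (dot v u)^*%C.
Proof. by have := hermC dot u v; rewrite expr0 mul1r. Qed.

Lemma dotDl u v w : dot (u + v) w = dot u w + dot v w.
Proof. by have := linearDl dot w u v. Qed.

Lemma dotZl z u v : dot (z *: u) v = z * dot u v.
Proof. by have := linearZl_LR dot v z u. Qed.

Lemma dotZr z u v : dot u (z *: v) = z^*%C * dot u v.
Proof. by rewrite dotC dotZl rmorphM /= -dotC. Qed.

Lemma ipC u v : ip u v = ip v u.
Proof. by rewrite /ip dotC; case: (dot v u). Qed.

Lemma ipDl u v w : ip (u + v) w = ip u w + ip v w.
Proof. by rewrite /ip dotDl; case: (dot u w) (dot v w) => ? ? []. Qed.

Lemma ipDr u v w : ip w (u + v) = ip w u + ip w v.
Proof. by rewrite ipC ipDl !(ipC w). Qed.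

Lemma ipZl a u v : ip (a%:C *: u) v = a * ip u v.
Proof. by rewrite /ip dotZl; case: (dot u v) => x y /=; rewrite mul0r subr0. Qed.

Lemma ipZr a u v : ip u (a%:C *: v) = a * ip u v.
Proof. by rewrite ipC ipZl ipC. Qed.

Lemma ipNl u v : ip (- u) v = - ip u v.
Proof. by have := ipZl (-1) u v; rewrite rmorphN rmorph1 scaleN1r mulN1r. Qed.

Lemma ipNr u v : ip u (- v) = - ip u v.
Proof. by rewrite ipC ipNl ipC. Qed.

Lemma ip0l u : ip 0 u = 0.
Proof. by have := ipZl 0 u u; rewrite rmorph0 scale0r mul0r. Qed.

Lemma ip0r u : ip u 0 = 0.
Proof. by rewrite ipC ip0l. Qed.

Definition ipE := (ipDl, ipDr, ipNl, ipNr, ipZl, ipZr, ip0l, ip0r).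

Lemma ip_suml n (f : nat -> H) v :
  ip (\sum_(0 <= k < n) f k) v = \sum_(0 <= k < n) ip (f k) v.
Proof.
elim: n => [|n IHn]; first by rewrite !big_geq// ip0l.
by rewrite !big_nat_recr //= ipDl IHn.
Qed.

Lemma ipxx u : ip u u = nr u ^+ 2.
Proof. by rewrite /ip -hH nrE -rmorphXn. Qed.

Lemma dot_xx u : dot u u = (nr u ^+ 2)%:C.
Proof. by rewrite -hH nrE rmorphXn. Qed.

(** Antilinearity on the right gives Re (u, i v) = Im (u, v); this is how real identities are
    carried back to the complex inner product. *)
Lemma dotE u v : dot u v = (ip u v)%:C + 'i%C * (ip u ('i%C *: v))%:C.
Proof.
rewrite /ip dotZr [LHS]complexE; congr (_ + _ * _%:C).
by case: (dot u v) => x y /=; rewrite mul0r sub0r mulN1r opprK.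
Qed.

Lemma ip_le u v : ip u v <= nr u * nr v.
Proof.
have [/nr_eq0->|u0] := eqVneq (nr u) 0; first by rewrite ip0l nr0 mul0r.
have [/nr_eq0->|v0] := eqVneq (nr v) 0; first by rewrite ip0r nr0 mulr0.
have up : 0 < nr u by rewrite lt_neqAle eq_sym u0 nr_ge0.
have vp : 0 < nr v by rewrite lt_neqAle eq_sym v0 nr_ge0.
(* Cauchy-Schwarz: this square expands to 2 |u| |v| (|u| |v| - (u, v)). *)
have := sqr_ge0 (nr ((nr v)%:C *: u - (nr u)%:C *: v)).
rewrite -ipxx !ipE !ipxx (ipC v u) => h.
have {}h : 2 * (nr u * nr v) * ip u v <= 2 * (nr u * nr v) * (nr u * nr v).
  by move: h; rewrite -subr_ge0 -[in X in _ -> X]subr_ge0; congr (_ <= _); ring.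
by rewrite -(ler_pM2l (_ : 0 < 2 * (nr u * nr v))) // !mulr_gt0.
Qed.

Lemma ip_norm_le u v : `|ip u v| <= nr u * nr v.
Proof. by rewrite ler_norml ip_le lerNl -ipNl -(nrN u) ip_le. Qed.

Lemma ip_ext u v : (forall w, ip u w = ip v w) -> u = v.
Proof.
move=> h; apply/eqP; rewrite -subr_eq0; apply/eqP/nr_eq0/eqP.
by rewrite -sqrf_eq0 -ipxx [ip (_ - _) (_ - _)]ipDl ipNl h subrr.
Qed.

Lemma dot_eq (u v u' v' : H) :
  ip u v = ip u' v' -> ip u ('i%C *: v) = ip u' ('i%C *: v') -> dot u v = dot u' v'.
Proof. by move=> e1 e2; rewrite dotE e1 e2 -dotE. Qed.

Lemma ip_i u v : ip ('i%C *: u) ('i%C *: v) = ip u v.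
Proof.
rewrite /ip dotZl dotZr; case: (dot u v) => x y /=.
by rewrite !(mul0r,mul1r,mulN1r,opprK,sub0r,add0r).
Qed.

Lemma ip_iC u v : ip ('i%C *: u) v = - ip u ('i%C *: v).
Proof.
rewrite /ip dotZl dotZr; case: (dot u v) => x y /=.
by rewrite !(mul0r,mul1r,mulN1r,opprK,sub0r,add0r).
Qed.

Lemma nr_le_pairing v (K : R) : 0 <= K -> (forall w, ip v w <= K * nr w) -> nr v <= K.
Proof.
move=> K0 h; have [/eqP|v0] := eqVneq (nr v) 0; first by move/eqP ->.
have vp : 0 < nr v by rewrite lt_neqAle eq_sym v0 nr_ge0.
by rewrite -(ler_pM2r vp) -expr2 -ipxx.
Qed.

End RealInnerProduct.

(** * Derivatives on the half-line *)

Section Derivatives.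
Variable R : realType.

Lemma ler_norm4 (x1 x2 x3 x4 y1 y2 y3 y4 : R) :
  `|x1| <= y1 -> `|x2| <= y2 -> `|x3| <= y3 -> `|x4| <= y4 ->
  `|x1 + x2 + x3 + x4| <= y1 + y2 + y3 + y4.
Proof.
move=> h1 h2 h3 h4; apply: le_trans (ler_normD _ _) (lerD _ h4).
apply: le_trans (ler_normD _ _) (lerD _ h3).
exact: le_trans (ler_normD _ _) (lerD h1 h2).
Qed.

(** Dividing by 1 + x rather than x spares the case x = 0 in every choice of a tolerance below. *)
Lemma div1D_le (e x : R) : 0 <= e -> 0 <= x -> e / (1 + x) * x <= e.
Proof.
move=> e0 x0; have x1 : 0 < 1 + x by rewrite ltr_pwDl.
by rewrite mulrAC ler_pdivrMr // ler_wpM2l // lerDr.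
Qed.

Lemma ler_addMgt0 (x y M : R) : 0 <= M -> (forall e, 0 < e -> x <= y + e * M) -> x <= y.
Proof.
move=> M0 hx; apply/ler_addgt0Pr => e e0.
apply: le_trans (hx (e / (1 + M)) _) _; first by rewrite divr_gt0 // ltr_pwDl.
by rewrite lerD2l div1D_le // ltW.
Qed.

(** Solutions live on t >= 0, so derivatives at 0 are one-sided and all others are ordinary. *)
Definition half_line_nbhs (t : R) : set_system R := within [set r | 0 <= r] (nbhs t).

Global Instance half_line_nbhs_filter t : Filter (half_line_nbhs t).
Proof. exact: within_filter. Qed.

Lemma half_line_near (t d : R) : 0 < d -> \forall r \near half_line_nbhs t, `|r - t| < d.
Proof.
move=> d0; rewrite /half_line_nbhs.
have := nbhsx_ballx t d d0; apply: filterS => r.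
by rewrite /ball /= distrC => h _.
Qed.

Lemma half_line_ge0 (t : R) : \forall r \near half_line_nbhs t, 0 <= r.
Proof. exact: withinT. Qed.

(** A first-order expansion with a non-strict error, so that r = t needs no exclusion. The same form
    serves in [hder], where time is real while the target is normed over [R[i]]. *)
Definition rder (F : R -> R) (t d : R) : Prop :=
  forall e, 0 < e -> \forall r \near half_line_nbhs t,
    `|F r - F t - (r - t) * d| <= e * `|r - t|.

Definition hder (V : normedModType R[i]) (f : R -> V) (t : R) (d : V) : Prop :=
  forall e : R, 0 < e -> \forall r \near half_line_nbhs t,
    nr (f r - f t - (r - t)%:C *: d) <= e * `|r - t|.

Lemma rder_cst (a t : R) : rder (fun=> a) t 0.
Proof. by move=> e e0; near=> r; rewrite subrr mulr0 subrr normr0 mulr_ge0 // ltW.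
Unshelve. all: by end_near. Qed.

Lemma rder_id (t : R) : rder id t 1.
Proof. by move=> e e0; near=> r; rewrite mulr1 subrr normr0 mulr_ge0 // ltW.
Unshelve. all: by end_near. Qed.

Lemma rderD (F G : R -> R) (t a b : R) :
  rder F t a -> rder G t b -> rder (fun r => F r + G r) t (a + b).
Proof.
move=> hF hG e e0; have e2 : 0 < e / 2 by rewrite divr_gt0.
near=> r.
have -> : F r + G r - (F t + G t) - (r - t) * (a + b) =
  (F r - F t - (r - t) * a) + (G r - G t - (r - t) * b) by ring.
rewrite (le_trans (ler_normD _ _)) // [e]splitr [leRHS]mulrDl lerD //; near: r.
  exact: hF.
exact: hG.
Unshelve. all: by end_near. Qed.

Lemma rder_cont (F : R -> R) (t a e : R) : rder F t a -> 0 < e ->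
  \forall r \near half_line_nbhs t, `|F r - F t| <= e.
Proof.
move=> hF e0; have c0 : 0 < 1 + `|a| by rewrite ltr_pwDl.
near=> r.
have -> : F r - F t = (F r - F t - (r - t) * a) + (r - t) * a by ring.
rewrite (le_trans (ler_normD _ _)) // normrM.
have h1 : `|F r - F t - (r - t) * a| <= 1 * `|r - t|.
  by near: r; apply: hF.
have h2 : `|r - t| < e / (1 + `|a|).
  by near: r; apply: half_line_near; rewrite divr_gt0.
have h3 := ltW h2; rewrite ler_pdivlMr // in h3.
by apply: le_trans (lerD h1 (lexx _)) _; rewrite mulrC -mulrDr.
Unshelve. all: by end_near. Qed.

Lemma rderM (F G : R -> R) (t a b : R) :
  rder F t a -> rder G t b -> rder (fun r => F r * G r) t (a * G t + F t * b).
Proof.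
move=> hF hG e e0.
have c0 : 0 < 1 + `|G t| + `|a| + `|F t| by rewrite !ltr_pwDl.
(* c adds up the coefficients of the four error terms below; the cap by 1 linearizes the term in
   which both factors vary. *)
set c := 1 + `|G t| + `|a| + `|F t| in c0.
have d0 : 0 < Num.min 1 (e / c) by rewrite lt_min ltr01 divr_gt0.
near=> r.
have -> : F r * G r - F t * G t - (r - t) * (a * G t + F t * b) =
  (F r - F t - (r - t) * a) * G t + (F r - F t - (r - t) * a) * (G r - G t)
  + (r - t) * (a * (G r - G t)) + F t * (G r - G t - (r - t) * b) by ring.
have h1 : `|F r - F t - (r - t) * a| <= e / c * `|r - t|.
  by near: r; apply: hF; rewrite divr_gt0.
have h2 : `|G r - G t - (r - t) * b| <= e / c * `|r - t|.
  by near: r; apply: hG; rewrite divr_gt0.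
have : `|G r - G t| <= Num.min 1 (e / c).
  by near: r; apply: rder_cont hG _.
rewrite le_min => /andP[h3 h4].
have cE : c * (e / c) = e by rewrite mulrC divfK // gt_eqF.
rewrite -[in leRHS]cE /c.
move: h1 h2 h4; set x := e / c => h1 h2 h4.
have x0 : 0 <= x by rewrite divr_ge0 // ltW.
have -> : (1 + `|G t| + `|a| + `|F t|) * x * `|r - t| =
  x * `|r - t| * `|G t| + x * `|r - t| * 1 + `|r - t| * (`|a| * x) + `|F t| * (x * `|r - t|).
  by ring.
apply: ler_norm4; rewrite !normrM.
- by rewrite ler_wpM2r.
- by rewrite ler_pM.
- by rewrite !ler_wpM2l.
- by rewrite ler_wpM2l.
Unshelve. all: by end_near. Qed.

Lemma rder_scale (F : R -> R) (c t a : R) : rder F t a -> rder (fun r => c * F r) t (c * a).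
Proof. by move=> hF; have := rderM (rder_cst c t) hF; rewrite mul0r add0r. Qed.

Section Vector.
Variable (V : normedModType R[i]).

Lemma hder_cont (f : R -> V) t d (e : R) : hder f t d -> 0 < e ->
  \forall r \near half_line_nbhs t, nr (f r - f t) <= e.
Proof.
move=> hf e0; have c0 : 0 < 1 + nr d by rewrite ltr_pwDl ?nr_ge0.
near=> r.
have h1 : nr (f r - f t - (r - t)%:C *: d) <= 1 * `|r - t|.
  by near: r; apply: hf.
have h2 : `|r - t| < e / (1 + nr d).
  by near: r; apply: half_line_near; rewrite divr_gt0.
have h3 := ltW h2; rewrite ler_pdivlMr // in h3.
rewrite -[X in nr X](subrK ((r - t)%:C *: d)) (le_trans (nrD _ _)) // nrZ.
by apply: le_trans (lerD h1 (lexx _)) _; rewrite mulrC -mulrDr.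
Unshelve. all: by end_near. Qed.

Lemma hder_cst (v : V) t : hder (fun=> v) t 0.
Proof. by move=> e e0; near=> r; rewrite subrr scaler0 subrr nr0 mulr_ge0 // ltW.
Unshelve. all: by end_near. Qed.

Lemma hderD (f g : R -> V) t a b :
  hder f t a -> hder g t b -> hder (fun r => f r + g r) t (a + b).
Proof.
move=> hf hg e e0; have e2 : 0 < e / 2 by rewrite divr_gt0.
near=> r.
have -> : f r + g r - (f t + g t) - (r - t)%:C *: (a + b) =
  (f r - f t - (r - t)%:C *: a) + (g r - g t - (r - t)%:C *: b).
  by rewrite scalerDr !opprD (addrACA (f r)) (addrACA (f r - f t)).
rewrite (le_trans (nrD _ _)) // [e]splitr [leRHS]mulrDl lerD //; near: r.
  exact: hf.
exact: hg.
Unshelve. all: by end_near. Qed.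

Lemma hder_sum (f : nat -> R -> V) (d : nat -> V) t n :
  (forall k, hder (f k) t (d k)) ->
  hder (fun r => \sum_(0 <= k < n) f k r) t (\sum_(0 <= k < n) d k).
Proof.
move=> h; elim: n => [|n IHn].
  by under eq_fun do rewrite big_geq//; rewrite big_geq//; exact: hder_cst.
under eq_fun do rewrite big_nat_recr//=.
by rewrite big_nat_recr //=; apply: hderD.
Qed.

Lemma hder_scale (F : R -> R) (a t : R) (v : V) :
  rder F t a -> hder (fun r => (F r)%:C *: v) t (a%:C *: v).
Proof.
move=> hF e e0; have c0 : 0 < 1 + nr v by rewrite ltr_pwDl ?nr_ge0.
near=> r.
have -> : (F r)%:C *: v - (F t)%:C *: v - (r - t)%:C *: (a%:C *: v) =
  (F r - F t - (r - t) * a)%:C *: v.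
  by rewrite scalerA -!scalerBl -rmorphM -!rmorphB.
have : `|F r - F t - (r - t) * a| <= e / (1 + nr v) * `|r - t|.
  by near: r; apply: hF; rewrite divr_gt0.
rewrite nrZ => /(ler_wpM2r (nr_ge0 v)) /le_trans; apply.
by rewrite mulrAC ler_wpM2r // div1D_le ?nr_ge0 ?ltW.
Unshelve. all: by end_near. Qed.

End Vector.

Lemma hder_lin (V W : normedModType R[i]) (T : V -> W) (K : R) (f : R -> V) t d :
  linear T -> (forall v, nr (T v) <= K * nr v) ->
  hder f t d -> hder (T \o f) t (T d).
Proof.
move=> linT hK hf e e0; have c0 : 0 < 1 + `|K| by rewrite ltr_pwDl.
have TB u v : T (u - v) = T u - T v.
  by rewrite -scaleN1r addrC linT scaleN1r addrC.
have TZ a v : T (a *: v) = a *: T v.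
  have T0 : T 0 = 0 by have := TB 0 0; rewrite !subrr.
  by have := linT a v 0; rewrite T0 !addr0.
near=> r; rewrite /= -TZ -!TB.
have : nr (f r - f t - (r - t)%:C *: d) <= e / (1 + `|K|) * `|r - t|.
  by near: r; apply: hf; rewrite divr_gt0.
set x := f r - _ - _ => hx; rewrite (le_trans (hK _)) //.
have: `|K| * nr x <= `|K| * (e / (1 + `|K|) * `|r - t|) by rewrite ler_wpM2l.
move/(le_trans (ler_wpM2r (nr_ge0 x) (ler_norm K))) => /le_trans; apply.
by rewrite mulrA ler_wpM2r // mulrC div1D_le // ltW.
Unshelve. all: by end_near. Qed.

Lemma rder_ip (H : completeNormedModType R[i]) (dot : {dot H for Num.conj})
    (f g : R -> H) t a b : hilbert_norm dot ->
  hder f t a -> hder g t b ->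
  rder (fun r => re_dot dot (f r) (g r)) t (re_dot dot a (g t) + re_dot dot (f t) b).
Proof.
move=> hH hF hG e e0.
have c0 : 0 < 1 + nr (g t) + nr a + nr (f t) by rewrite !ltr_pwDl ?nr_ge0.
set c := 1 + nr (g t) + nr a + nr (f t) in c0.
have d0 : 0 < Num.min 1 (e / c) by rewrite lt_min ltr01 divr_gt0.
near=> r.
have -> : re_dot dot (f r) (g r) - re_dot dot (f t) (g t)
      - (r - t) * (re_dot dot a (g t) + re_dot dot (f t) b) =
  re_dot dot (f r - f t - (r - t)%:C *: a) (g t)
  + re_dot dot (f r - f t - (r - t)%:C *: a) (g r - g t)
  + (r - t) * re_dot dot a (g r - g t) + re_dot dot (f t) (g r - g t - (r - t)%:C *: b).
  by rewrite !ipE; ring.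
have h1 : nr (f r - f t - (r - t)%:C *: a) <= e / c * `|r - t|.
  by near: r; apply: hF; rewrite divr_gt0.
have h2 : nr (g r - g t - (r - t)%:C *: b) <= e / c * `|r - t|.
  by near: r; apply: hG; rewrite divr_gt0.
have : nr (g r - g t) <= Num.min 1 (e / c).
  by near: r; apply: hder_cont hG _.
rewrite le_min => /andP[h3 h4].
have cE : c * (e / c) = e by rewrite mulrC divfK // gt_eqF.
rewrite -[in leRHS]cE /c.
move: h1 h2 h4; set x := e / c => h1 h2 h4.
have x0 : 0 <= x by rewrite divr_ge0 // ltW.
have -> : (1 + nr (g t) + nr a + nr (f t)) * x * `|r - t| =
  x * `|r - t| * nr (g t) + x * `|r - t| * 1 + `|r - t| * (nr a * x)
  + nr (f t) * (x * `|r - t|).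
  by ring.
apply: ler_norm4.
- by rewrite (le_trans (ip_norm_le hH _ _)) // ler_wpM2r ?nr_ge0.
- by rewrite (le_trans (ip_norm_le hH _ _)) // ler_pM ?nr_ge0.
- rewrite normrM ler_wpM2l //.
  by rewrite (le_trans (ip_norm_le hH _ _)) // ler_wpM2l ?nr_ge0.
- by rewrite (le_trans (ip_norm_le hH _ _)) // ler_wpM2l ?nr_ge0.
Unshelve. all: by end_near. Qed.

Lemma is_derive_rder (F : R -> R) (t a : R) : is_derive t 1 F a -> rder F t a.
Proof.
move=> hF e e0.
have := @ex_derive _ _ _ _ _ _ _ hF; rewrite /derivable => /cvg_ex[l hl].
have la : l = a by rewrite -(@derive_val _ _ _ _ _ _ _ hF) /derive; exact/esym/cvg_lim.
rewrite {l}la in hl.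
move/cvgrPdist_le : hl => /(_ e e0) [d /= d0 hd].
have := half_line_near t d0; apply: filterS => r rd.
have [->|rt] := eqVneq r t; first by rewrite !subrr mul0r subrr normr0 mulr0.
have rt0 : r - t != 0 by rewrite subr_eq0.
have := hd (r - t); rewrite /= sub0r normrN => /(_ rd rt0).
rewrite [_ *: 1]mulr1 subrK -(ler_pM2r (_ : 0 < `|r - t|)) ?normr_gt0 //.
rewrite -normrM mulrBl [_^-1 *: _]mulrC divfK // distrC.
by rewrite [a * _]mulrC.
Qed.

(** For t > 0 a small two-sided neighbourhood of t lies in the half-line. *)
Lemma rder_is_derive (F : R -> R) (t a : R) : 0 < t -> rder F t a -> is_derive t 1 F a.
Proof.
move=> t0 hF.
have h : h^-1 *: (F (h *: 1 + t) - F t) @[h --> 0^'] --> a.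
  apply/cvgrPdist_le => e /hF [d /= d0 hd].
  near=> h.
  have h0 : h != 0 by near: h; exact: nbhs_dnbhs_neq.
  have hlt : `|h| < Num.min d t.
    by near: h; apply: dnbhs0_lt; rewrite lt_min d0.
  move: hlt; rewrite lt_min => /andP[h1 h2].
  have ht : 0 <= h + t by have := ltW h2; rewrite ler_norml => /andP[]; lra.
  have := hd (h + t); rewrite /= /ball /= (_ : t - (h + t) = - h); last by ring.
  rewrite normrN => /(_ h1 ht); rewrite addrK.
  move=> hh; rewrite [_ *: 1]mulr1 -(ler_pM2r (_ : 0 < `|h|)) ?normr_gt0 //.
  move: hh.
  suff -> : F (h + t) - F t - h * a = - ((a - h^-1 *: (F (h + t) - F t)) * h).
    by rewrite normrN normrM.
  by rewrite [_ *: _]mulrC mulrBl divfK //; ring.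
apply: DeriveDef; first by apply/cvg_ex; exists a.
by rewrite /derive; apply/cvg_lim.
Unshelve. all: by end_near. Qed.

(** The mean value theorem asks for two-sided derivatives only in the open interval, hence at
    positive times, so a = 0 is allowed. *)
Lemma rder_le0_nincr (F F' : R -> R) (a b : R) : 0 <= a -> a <= b ->
  (forall t, a <= t <= b -> rder F t (F' t)) ->
  (forall t, a <= t <= b -> F' t <= 0) -> F b <= F a.
Proof.
move=> a0 ab hF hF'.
have [||c cab] := @MVT_segment R F F' a b ab.
- move=> x; rewrite in_itv /= => /andP[ax xb].
  by apply: rder_is_derive; [exact: le_lt_trans ax|apply: hF; rewrite !ltW].
- apply/subspace_continuousP => x; rewrite /= in_itv /= => xab.
  apply/cvgrPdist_le => e e0; have := rder_cont (hF x xab) e0.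
  rewrite /half_line_nbhs /within /= => hr; apply: (@filterS _ (nbhs x) _ _ _ _ hr) => r + rab.
  rewrite distrC => h; apply: h; move: rab; rewrite /= in_itv /= => /andP[ar _].
  exact: le_trans ar.
move: cab; rewrite in_itv /= => /hF' h e; rewrite -subr_le0 e.
by rewrite mulr_le0_ge0 // subr_ge0.
Qed.

End Derivatives.

(** * Orthogonality and self-adjoint operators *)

Section Hilbert.
Variables (R : realType) (H : completeNormedModType R[i]).
Variable dot : {dot H for Num.conj}.
Hypothesis hH : hilbert_norm dot.
Implicit Types (u v w : H) (A : operator H) (V : set H).
Local Notation ip := (re_dot dot).

Lemma dense_nr V u (e : R) : dense V -> 0 < e -> exists2 v, V v & nr (u - v) < e.
Proof.
move=> dV e0.
have ec0 : 0 < e%:C :> R[i] by rewrite -[0]/((0 : R)%:C) ltcR.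
have [v []] := dV (ball u e%:C) (ex_intro _ u (ballxx u ec0)) (ball_open u e%:C).
by rewrite -ball_normE /= nrE ltcR => h Vv; exists v.
Qed.

Lemma dense_ip_eq0 V w : dense V -> (forall v, V v -> ip w v = 0) -> w = 0.
Proof.
move=> dV h; apply/nr_eq0/eqP; rewrite eq_le nr_ge0 andbT.
apply/ler_addgt0Pr => e e0; rewrite add0r.
have [v Vv wv] := dense_nr w dV e0.
have [/eqP|w0] := eqVneq (nr w) 0; first by move/eqP ->; exact: ltW.
have wp : 0 < nr w by rewrite lt_neqAle eq_sym w0 nr_ge0.
rewrite -(ler_pM2l wp) -expr2 -(ipxx hH).
have -> : ip w w = ip w (w - v) by rewrite ipDr ipNr (h v Vv) subr0.
by rewrite (le_trans (ip_le hH _ _)) // ler_wpM2l ?nr_ge0 // ltW.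
Qed.

Lemma cauchy_nr_cvg (f : nat -> H) :
  (forall e : R, 0 < e -> exists N, forall m n, (N <= m)%N -> (N <= n)%N ->
    nr (f m - f n) < e) ->
  exists l, forall e : R, 0 < e -> exists N, forall n, (N <= n)%N -> nr (f n - l) < e.
Proof.
move=> hf.
have fE : cauchy_ex (f @ \oo).
  move=> e e0; have eE : e = (complex.Re e)%:C by rewrite RRe_real // gtr0_real.
  have /hf[N hN] : 0 < complex.Re e by rewrite -ltcR -eE.
  exists (f N), N => // n /= Nn.
  by rewrite -ball_normE /= nrE eE ltcR hN.
have /cvg_ex[l] : cvg (f @ \oo) by apply/cauchy_cvgP; exact: cauchy_exP.
move=> /cvg_nr hl; exists l => e /hl [N _ hN]; exists N => n Nn; exact: hN.
Qed.

Definition real_subspace V := V 0 /\ forall (a : R) u v, V u -> V v -> V (u + a%:C *: v).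

(** The projection theorem for a subspace that need not be closed: a minimizing sequence for the
    distance to u converges in H, u minus its limit is orthogonal to V, hence u is that limit. *)
Lemma orthogonal_trivial_dense V u (e : R) : real_subspace V ->
  (forall w, (forall v, V v -> ip w v = 0) -> w = 0) ->
  0 < e -> exists2 v, V v & nr (u - v) < e.
Proof.
move=> [V0 VD] hV e0.
pose D := [set nr (u - v) ^+ 2 | v in V].
have D0 : D !=set0 by exists (nr (u - 0) ^+ 2), 0.
have Dlb : has_lbound D by exists 0 => _ [v _ <-]; rewrite sqr_ge0.
have Dinf : has_inf D by split.
pose d := inf D.
have dle v : V v -> d <= nr (u - v) ^+ 2 by move=> Vv; apply: ge_inf => //; exists v.
have pr (n : nat) : exists v, V v /\ nr (u - v) ^+ 2 < d + n.+1%:R^-1.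
  have n0 : 0 < (n.+1%:R^-1 : R) by rewrite invr_gt0.
  have [_ [v Vv <-] hv] := inf_adherent n0 Dinf.
  by exists v.
have [f hf] := choice pr.
have par m n : nr (f m - f n) ^+ 2 <= 2 * (m.+1%:R^-1 + n.+1%:R^-1).
  (* The parallelogram identity uses the distance from u to the midpoint, which is spelled through
     the closure rule of [real_subspace], starting from 0 = f m - f m. *)
  have /dle : V ((f m + (-1)%:C *: (f m)) + (2^-1)%:C *: (f m + 1%:C *: f n)).
    by have [Vm _] := hf m; have [Vn _] := hf n; do ![assumption | apply: (VD)].
  have [_] := hf m; have [_] := hf n.
  rewrite -!(ipxx hH) !ipE (ipC dot u (f m)) (ipC dot u (f n)) (ipC dot (f n) (f m)).
  by move: (m.+1%:R^-1 : R) (n.+1%:R^-1 : R) => a b; lra.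
have [l hl] : exists l, forall e : R, 0 < e -> exists N, forall n, (N <= n)%N -> nr (f n - l) < e.
  apply: cauchy_nr_cvg => x x0.
  have x40 : 0 < x ^+ 2 / 4 by rewrite divr_gt0 // exprn_gt0.
  have [N _ hN] := near_infty_natSinv_lt (PosNum x40).
  exists N => m n /hN /= hm /hN /= hn.
  rewrite -(ltr_pXn2r (_ : (0 < 2)%N)) ?nnegrE ?nr_ge0 ?(ltW x0) //.
  apply: le_lt_trans (par m n) _; move: hm hn.
  by move: (m.+1%:R^-1 : R) (n.+1%:R^-1 : R) (x ^+ 2) => a b y /=; lra.
have wE v : V v -> ip (u - l) v = 0.
  move=> Vv; pose x := ip (u - l) v.
  have key s : 2 * s * x <= s ^+ 2 * nr v ^+ 2.
    apply/ler_addgt0Pr => y y0.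
    have c0 : 0 < y / 2 / (1 + 2 * `|s| * nr v).
      by rewrite !divr_gt0 // ltr_pwDl // !mulr_ge0 ?nr_ge0.
    have [N1 hN1] := hl _ c0.
    have y2 : 0 < y / 2 by rewrite divr_gt0.
    have [N2 _ hN2] := near_infty_natSinv_lt (PosNum y2).
    pose n := maxn N1 N2.
    have /ltW h1 := hN1 n (leq_maxl _ _); have /ltW h2 := hN2 n (leq_maxr _ _).
    have [Vn /ltW hn] := hf n.
    have := dle _ (VD s _ _ Vn Vv); move: hn h2 => /=.
    rewrite -!(ipxx hH) !ipE (ipC dot u (f n)) (ipC dot v u) (ipC dot v (f n)).
    have : 2 * s * ip (f n - l) v <= y / 2.
      apply: le_trans (ler_norm _) _; rewrite !normrM ger0_norm //.
      apply: (@le_trans _ _ (2 * `|s| * nr v * (y / 2 / (1 + 2 * `|s| * nr v)))).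
        rewrite -!mulrA !ler_wpM2l //; apply: le_trans (ip_norm_le hH _ _) _.
        by rewrite mulrC ler_wpM2l ?nr_ge0 // !mulrA.
      by rewrite mulrC div1D_le ?(ltW y2) // !mulr_ge0 ?nr_ge0.
    rewrite /x !ipE; move: (n.+1%:R^-1 : R) => z; lra.
  have v1 : 0 < 1 + nr v ^+ 2 by rewrite ltr_pwDl ?sqr_ge0.
  (* Close to the optimal s = x / |v|^2, but meaningful for v = 0. The inequality becomes 2 x^2 <=
     x^2 |v|^2 / (1 + |v|^2) <= x^2. *)
  have := key (x / (1 + nr v ^+ 2)).
  have -> : 2 * (x / (1 + nr v ^+ 2)) * x = 2 * x ^+ 2 / (1 + nr v ^+ 2) by field; rewrite gt_eqF.
  have -> : (x / (1 + nr v ^+ 2)) ^+ 2 * nr v ^+ 2 =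
     (x ^+ 2 / (1 + nr v ^+ 2) * nr v ^+ 2) / (1 + nr v ^+ 2) by field; rewrite gt_eqF.
  rewrite ler_pM2r ?invr_gt0 // => h.
  have := le_trans h (div1D_le (sqr_ge0 x) (sqr_ge0 (nr v))).
  move=> h2; apply/eqP; rewrite -sqrf_eq0 eq_le sqr_ge0 andbT -/x; lra.
have lu : u - l = 0 by apply: hV.
have [N hN] := hl e e0; exists (f N); first by have [] := hf N.
by move/eqP: lu; rewrite subr_eq0 => /eqP ->; rewrite nrBC hN.
Qed.

End Hilbert.

(** * Ranges and coercivity of self-adjoint operators *)

Section SelfAdjoint.
Variables (R : realType) (H : completeNormedModType R[i]).
Variable dot : {dot H for Num.conj}.
Hypothesis hH : hilbert_norm dot.
Local Notation ip := (re_dot dot).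
Implicit Types (u v w : H).

Lemma operator_lin (A : operator H) (a : R) u v : linear_operator A ->
  dom A u -> dom A v -> dom A (u + a%:C *: v) /\ A (u + a%:C *: v) = A u + a%:C *: A v.
Proof. by move=> [_ h] Au Av; rewrite addrC [RHS]addrC; apply: h. Qed.

Lemma operatorD (A : operator H) u v : linear_operator A ->
  dom A u -> dom A v -> dom A (u + v) /\ A (u + v) = A u + A v.
Proof. by move=> lA Au Av; have := operator_lin 1 lA Au Av; rewrite !scale1r. Qed.

Lemma operatorB (A : operator H) u v : linear_operator A ->
  dom A u -> dom A v -> dom A (u - v) /\ A (u - v) = A u - A v.
Proof.
by move=> lA Au Av; have := operator_lin (-1) lA Au Av; rewrite rmorphN1 !scaleN1r.
Qed.

Lemma operatorZi (A : operator H) (z : R[i]) u : linear_operator A ->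
  dom A u -> dom A (z *: u) /\ A (z *: u) = z *: A u.
Proof.
move=> [A0 h] Au; have [h1 h2] := h 1 0 0 A0 A0.
have A00 : A 0 = 0.
  by move: h2; rewrite scaler0 addr0 scale1r => /eqP; rewrite -subr_eq0 opprD addNKr oppr_eq0 => /eqP.
by have := h z u 0 Au A0; rewrite A00 !addr0.
Qed.

Lemma self_adjoint_sym (A : operator H) u v : self_adjoint dot A ->
  dom A u -> dom A v -> ip (A u) v = ip u (A v).
Proof.
move=> [_ _ h] Au Av; rewrite /ip; congr complex.Re.
by have [h1 _] := h v (A v); apply: h1.
Qed.

(** Real parts suffice to recognize the adjoint: testing with i u recovers the imaginary part. *)
Lemma self_adjoint_dom (A : operator H) v w : self_adjoint dot A ->
  (forall u, dom A u -> ip (A u) v = ip u w) -> dom A v /\ A v = w.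
Proof.
move=> [lA _ h] hvw; apply/(h v w) => u Au; apply: dot_eq; first exact: hvw.
apply: oppr_inj; rewrite -!ip_iC.
by have [Aiu <-] := operatorZi 'i%C lA Au; apply: hvw.
Qed.

Lemma everywhere_sym (T : H -> H) u v : self_adjoint dot (everywhere T) ->
  ip (T u) v = ip u (T v).
Proof. by move=> h; have := @self_adjoint_sym (everywhere T) u v h; apply. Qed.

Lemma positive_ip (A : operator H) u : positive dot A -> dom A u ->
  linear_operator A -> 0 <= ip (A u) u.
Proof.
move=> pA Au lA; have [->|u0] := eqVneq u 0; first by rewrite ip0r.
by have := pA u Au u0; rewrite ltcE /= => /andP[_ /ltW].
Qed.

Lemma positive_inj (A : operator H) u : positive dot A -> dom A u ->
  ip (A u) u <= 0 -> u = 0.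
Proof.
move=> pA Au h; apply/eqP/negPn/negP => u0.
by have := pA u Au u0; rewrite ltcE /= => /andP[_]; rewrite ltNge => /negP; apply.
Qed.

(** A vector w orthogonal to the range is in the domain of the adjoint, so A w = 0, and positivity
    forces w = 0. *)
Lemma dense_range (A : operator H) u (e : R) : self_adjoint dot A -> positive dot A ->
  0 < e -> exists2 v, dom A v & nr (u - A v) < e.
Proof.
move=> sA pA e0; have [lA _ _] := sA.
have sub : real_subspace [set A v | v in dom A].
  split; first by exists 0; [case: lA|have [_] := operatorB lA lA.1 lA.1; rewrite !subrr].
  move=> a _ _ [v Av <-] [w Aw <-]; have [Avw E] := operator_lin a lA Av Aw.
  by exists (v + a%:C *: w).
have [|_ [v Av <-] h] := orthogonal_trivial_dense hH u sub _ e0; last by exists v.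
move=> w hw; have [v Av|Aw A0] := @self_adjoint_dom A w 0 sA.
  by rewrite ip0r ipC hw //; exists v.
by apply: (positive_inj pA) => //; rewrite A0 ip0l.
Qed.

Lemma coercive_nr_le (A : operator H) (T : H -> H) u :
  0 <= ip (A u) u -> nr u ^+ 2 <= ip (T u) u -> nr u <= nr (A u + T u).
Proof.
move=> Au Tu; have [->|u0] := eqVneq (nr u) 0; first exact: nr_ge0.
have up : 0 < nr u by rewrite lt_neqAle eq_sym u0 nr_ge0.
rewrite -(ler_pM2r up) -expr2 (le_trans Tu) //.
by apply: le_trans (ip_le hH _ _); rewrite ipDl lerDr.
Qed.

(** A vector w orthogonal to the range of A + T satisfies A w = - T w, against coercivity, so the
    range is dense. The lower bound |u| <= |(A + T) u| makes approximate solutions Cauchy, and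
    self-adjointness of A puts their limit in the domain. *)
Lemma coercive_surjective (A : operator H) (T : H -> H) (K : R) g :
  self_adjoint dot A -> (forall u, dom A u -> 0 <= ip (A u) u) ->
  linear T -> (forall u, nr (T u) <= K * nr u) ->
  (forall u v, ip (T u) v = ip u (T v)) -> (forall u, nr u ^+ 2 <= ip (T u) u) ->
  exists2 p, dom A p & A p + T p = g.
Proof.
move=> sA pA lT bT sT cT; have [lA _ _] := sA.
have TB u v : T (u - v) = T u - T v.
  by rewrite -scaleN1r addrC lT scaleN1r addrC.
have low u : dom A u -> nr u <= nr (A u + T u).
  by move=> Au; apply: coercive_nr_le; rewrite ?pA.
have TD (a : R) u v : T (u + a%:C *: v) = T u + a%:C *: T v.
  by rewrite addrC lT addrC.
have sub : real_subspace [set A v + T v | v in dom A].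
  split.
    exists 0; first by case: lA.
    have [_] := operatorB lA lA.1 lA.1; rewrite !subrr => ->.
    by have := TB 0 0; rewrite !subrr => ->; rewrite addr0.
  move=> a _ _ [v Av <-] [w Aw <-]; have [Avw E] := operator_lin a lA Av Aw.
  by exists (v + a%:C *: w) => //; rewrite E TD scalerDr addrACA.
have pr (n : nat) : exists v, dom A v /\ nr (g - (A v + T v)) < n.+1%:R^-1.
  have n0 : 0 < (n.+1%:R^-1 : R) by rewrite invr_gt0.
  have [|_ [v Av <-] h] := orthogonal_trivial_dense hH g sub _ n0; last by exists v.
  move=> w hw; have [v Av|Aw A0] := @self_adjoint_dom A w (- T w) sA.
    have := hw (A v + T v); rewrite ipDr ipNr (ipC dot w) -(sT w v) (ipC dot _ v) => h.
    by apply/eqP; rewrite -subr_eq0 opprK; apply/eqP; apply: h; exists v.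
  have := cT w; have := pA w Aw; rewrite A0 ipNl => h1 h2.
  by apply/nr_eq0/eqP; rewrite -sqrf_eq0 eq_le sqr_ge0 andbT; lra.
have [f hf] := choice pr.
have [p hp] : exists l, forall e : R, 0 < e -> exists N, forall n, (N <= n)%N -> nr (f n - l) < e.
  apply: cauchy_nr_cvg => e e0.
  have e2 : 0 < e / 2 by rewrite divr_gt0.
  have [N _ hN] := near_infty_natSinv_lt (PosNum e2).
  exists N => m n /hN /= hm /hN /= hn.
  have [Am /lt_trans/(_ hm) {}hm] := hf m; have [An /lt_trans/(_ hn) {}hn] := hf n.
  have [Amn Emn] := operatorB lA Am An.
  apply: le_lt_trans (low _ Amn) _; rewrite Emn TB.
  have -> : A (f m) - A (f n) + (T (f m) - T (f n)) =
    (g - (A (f n) + T (f n))) - (g - (A (f m) + T (f m))).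
    by apply: (ip_ext hH) => w; rewrite !ipE; ring.
  by apply: le_lt_trans (nrB _ _) _; lra.
have [|Ap Ep] := @self_adjoint_dom A p (g - T p) sA; last first.
  by exists p => //; rewrite Ep subrK.
move=> u Au; apply/eqP; rewrite -subr_eq0 -normr_le0; apply/ler_addgt0Pr => e e0.
rewrite add0r.
have c0 : 0 < 1 + (nr (A u) + `|K| * nr u + nr u).
  by rewrite ltr_pwDl // !addr_ge0 ?mulr_ge0 ?nr_ge0.
have d0 := divr_gt0 e0 c0; set d := e / _ in d0.
have [N1 hN1] := hp d d0.
have [N2 _ hN2] := near_infty_natSinv_lt (PosNum d0).
pose n := maxn N1 N2.
have /ltW h1 := hN1 n (leq_maxl _ _); have h2 := hN2 n (leq_maxr _ _).
have [An /lt_trans/(_ h2) /ltW hn] := hf n.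
have -> : ip (A u) p - ip u (g - T p) =
  - ip (A u) (f n - p) - ip u (g - (A (f n) + T (f n))) - ip u (T (f n - p)).
  by rewrite TB !ipE (self_adjoint_sym sA Au An); ring.
apply: (@le_trans _ _ (nr (A u) * d + nr u * d + nr u * (`|K| * d))).
  apply: le_trans (ler_normB _ _) (lerD (le_trans (ler_normB _ _) (lerD _ _)) _).
  - by rewrite normrN (le_trans (ip_norm_le hH _ _)) // ler_wpM2l ?nr_ge0.
  - by rewrite (le_trans (ip_norm_le hH _ _)) // ler_wpM2l ?nr_ge0.
  - rewrite (le_trans (ip_norm_le hH _ _)) // ler_wpM2l ?nr_ge0 //.
    rewrite (le_trans (bT _)) // (le_trans (ler_wpM2r (nr_ge0 _) (ler_norm K))) //.
    by rewrite ler_wpM2l.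
apply: le_trans (div1D_le (ltW e0) (_ : 0 <= nr (A u) + `|K| * nr u + nr u)).
  by rewrite -/d; nra.
by rewrite !addr_ge0 ?mulr_ge0 ?nr_ge0.
Qed.

End SelfAdjoint.

(** * Spectral slabs *)

Section Spectral.
Variables (R : realType) (H : completeNormedModType R[i]).
Variable dot : {dot H for Num.conj}.
Hypothesis hH : hilbert_norm dot.
Local Notation ip := (re_dot dot).
Implicit Types (u v w : H).
Local Notation T := (measurableTypeR R).
Local Notation pvm := (projection_valued_measure dot).

Section Projections.
Variable E : set T -> H -> H.
Hypothesis hE : pvm E.
Implicit Types (X Y : set T).

Lemma pvm_sym X u v : measurable X -> ip (E X u) v = ip u (E X v).
Proof. by move=> mX; case: hE => /(_ X mX)[_ h] _ _ _ _; rewrite /ip h. Qed.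

Lemma pvmI X Y u : measurable X -> measurable Y -> E (X `&` Y) u = E X (E Y u).
Proof. by move=> mX mY; case: hE => _ h _ _ _; apply: h. Qed.

Lemma pvmK X u : measurable X -> E X (E X u) = E X u.
Proof. by move=> mX; rewrite -pvmI // setIid. Qed.

Lemma pvm_lin X (a : R) u v : measurable X -> E X (u + a%:C *: v) = E X u + a%:C *: E X v.
Proof. by move=> mX; case: hE => /(_ X mX)[h _] _ _ _ _; rewrite addrC h addrC. Qed.

Lemma pvmD X u v : measurable X -> E X (u + v) = E X u + E X v.
Proof. by move=> mX; have := pvm_lin 1 u v mX; rewrite !scale1r. Qed.

Lemma pvm0 X : measurable X -> E X 0 = 0.
Proof.
by move=> mX; have := pvm_lin (-1) 0 0 mX; rewrite rmorphN1 !scaleN1r !subrr.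
Qed.

Lemma pvm_ip X u : measurable X -> nr (E X u) ^+ 2 = ip (E X u) u.
Proof. by move=> mX; rewrite -(ipxx hH) -pvm_sym // pvmK. Qed.

Lemma pvm_set0 u : E set0 u = 0. Proof. by case: hE. Qed.
Lemma pvm_setT u : E setT u = u. Proof. by case: hE. Qed.

Lemma pvm_sigma (F : nat -> set T) u : (forall n, measurable (F n)) -> trivIset setT F ->
  \sum_(0 <= k < n) E (F k) u @[n --> \oo] --> E (\bigcup_n F n) u.
Proof. by move=> mF tF; case: hE => _ _ _ _; apply. Qed.

Lemma spectral_massE u X : spectral_mass E u X = (nr (E X u) ^+ 2)%:E.
Proof. by rewrite /spectral_mass nrE -rmorphXn. Qed.

Lemma spectral_mass_ge0 u X : (0 <= spectral_mass E u X)%E.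
Proof. by rewrite spectral_massE lee_fin sqr_ge0. Qed.

Lemma spectral_mass_set0 u : spectral_mass E u set0 = 0%E.
Proof. by rewrite spectral_massE pvm_set0 nr0 expr0n. Qed.

(** The mass |E(X) u|^2 equals (E(X) u, u), which is linear in E(X) u, so strong countable
    additivity of E passes to it. *)
Lemma spectral_mass_sigma_additive u : semi_sigma_additive (spectral_mass E u).
Proof.
move=> F mF tF mUF.
have massE X : measurable X -> spectral_mass E u X = (ip (E X u) u)%:E.
  by move=> mX; rewrite spectral_massE pvm_ip.
rewrite massE //.
have -> : (fun n => \sum_(0 <= i < n) spectral_mass E u (F i))%E =
    EFin \o (fun n => ip (\sum_(0 <= i < n) E (F i) u) u).
  apply/funext => n /=; rewrite ip_suml -sumEFin; apply: eq_bigr => i _.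
  by rewrite massE.
apply: cvg_EFin; first exact: nearW.
apply/cvgrPdist_lt => e e0.
have e2 : 0 < e / 2 by rewrite divr_gt0.
have c0 : 0 < e / 2 / (1 + nr u) by rewrite divr_gt0 // ltr_pwDl ?nr_ge0.
have /cvg_nr/(_ _ c0) := pvm_sigma (u := u) mF tF; apply: filterS => n /ltW hn.
rewrite distrC /= -ipNl -ipDl (le_lt_trans (ip_norm_le hH _ _)) //.
apply: le_lt_trans (ler_wpM2r (nr_ge0 u) hn) _.
by apply: le_lt_trans (div1D_le (ltW e2) (nr_ge0 u)) _; lra.
Qed.

End Projections.

(** The proofs are arguments so that the measure structure, which depends on them, can be inferred
    from the term. *)
Definition spectral_measure (_ : hilbert_norm dot) E (_ : pvm E) u : set T -> \bar R :=
  spectral_mass E u.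

HB.instance Definition _ E (hE : pvm E) u := @isMeasure.Build _ T R
  (spectral_measure hH hE u) (spectral_mass_set0 hE u) (spectral_mass_ge0 E u)
  (@spectral_mass_sigma_additive _ hE u).

End Spectral.

(** * Quadratic forms as integrals against spectral measures *)

Section SpectralIntegral.
Variables (R : realType) (H : completeNormedModType R[i]).
Variable dot : {dot H for Num.conj}.
Hypothesis hH : hilbert_norm dot.
Local Notation ip := (re_dot dot).
Implicit Types (u v w : H).
Local Notation T := (measurableTypeR R).
Local Notation pvm := (projection_valued_measure dot).

Section OneMeasure.
Variable E : set T -> H -> H.
Hypothesis hE : pvm E.
Implicit Types (X Y : set T).
Local Notation mu := (spectral_measure hH hE).

Lemma spectral_measureE u X : mu u X = (nr (E X u) ^+ 2)%:E.
Proof. exact: spectral_massE. Qed.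

Lemma spectral_measure_setT u : mu u setT = (nr u ^+ 2)%:E.
Proof. by rewrite spectral_measureE (pvm_setT hE). Qed.

Lemma spectral_measure_out u X : measurable X -> E X u = u -> mu u (~` X) = 0%E.
Proof.
move=> mX uX; rewrite spectral_measureE -uX -(pvmI hE) ?setICl //; last exact: measurableC.
by rewrite (pvm_set0 hE) nr0 expr0n.
Qed.

(** Additivity in the vector rather than in the set: it splits integrals, hence domains and
    quadratic forms, along X. *)
Lemma spectral_measure_split u X Y : measurable X -> measurable Y ->
  mu u Y = (mu (E X u) Y + mu (E (~` X) u) Y)%E.
Proof.
move=> mX mY; have mXC := measurableC mX.
have -> : mu u Y = (mu u (Y `&` X) + mu u (Y `&` ~` X))%E.
  by rewrite -setDE addeC; exact: (measureDI (mu u) mY mX).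
by rewrite !spectral_measureE !(pvmI hE).
Qed.

(** Pythagoras gives |u|^2 = |E(X) u|^2 + |E(~X) u|^2, and with the two projections orthogonal this
    makes the difference have norm 0. *)
Lemma pvm_compl u X : measurable X -> u = E X u + E (~` X) u.
Proof.
move=> mX; have mXC := measurableC mX.
have h0 w : ip (E X u) (E (~` X) w) = 0.
  by rewrite (pvm_sym hE) // -(pvmI hE) // setICr (pvm_set0 hE) ip0r.
have := spectral_measure_split u mX measurableT.
rewrite !spectral_measure_setT -EFinD => -[e].
apply/eqP; rewrite -subr_eq0; apply/eqP/nr_eq0/eqP; rewrite -sqrf_eq0.
move: e; rewrite !(pvm_ip hH hE) // -!(ipxx hH) => e.
rewrite !ipE (ipC dot u (E X u)) (ipC dot u (E (~` X) u)) (ipC dot (E (~` X) u) (E X u)).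
rewrite h0 (ipxx hH (E X u)) (ipxx hH (E (~` X) u)) !(pvm_ip hH hE) // e.
by apply/eqP; ring.
Qed.

Lemma integral_spectral_cst u (b : R) :
  (\int[mu u]_x (cst b%:E : T -> \bar R) x = (b * nr u ^+ 2)%:E)%E.
Proof.
rewrite integral_cst // EFinM; congr (_ * _)%E; exact: spectral_measure_setT.
Qed.

Lemma spectral_integrable_cst u (b : R) : (mu u).-integrable setT (cst b%:E : T -> \bar R).
Proof.
apply/integrableP; split; first exact: measurable_cst.
rewrite (eq_integral (cst `|b|%:E)) => [|x _] //.
by rewrite integral_spectral_cst ltry.
Qed.

Variables (f : R -> R) (A : operator H).
Hypothesis mf : measurable_fun (setT : set T) (f : T -> R).
Hypothesis hA : spectral_integral dot E f A.

Lemma spectral_integral_linear : linear_operator A. Proof. by case: hA. Qed.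

Lemma measurable_sqr_EFin : measurable_fun (setT : set T) (EFin \o (fun x : T => (f x) ^+ 2)).
Proof. by apply/measurable_EFinP; exact: measurable_funX. Qed.

Lemma spectral_dom_proj u X : measurable X -> dom A u -> dom A (E X u).
Proof.
move=> mX; case: hA => _ -> _ /=; apply: le_lt_trans.
have mXC := measurableC mX.
pose nu := measure_add (mu (E X u)) (mu (E (~` X) u)).
rewrite -[X in (_ <= X)%E]/(\int[mu u]_x ((f x) ^+ 2)%:E)%E.
rewrite -[X in (X <= _)%E]/(\int[mu (E X u)]_x ((f x) ^+ 2)%:E)%E.
rewrite [leRHS](eq_measure_integral nu) => [|Y mY _]; last first.
  exact: eq_trans (spectral_measure_split u mX mY) (esym (measure_addE _ _ _)).
rewrite ge0_integral_measure_add //; first last.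
- exact: measurable_sqr_EFin.
- by move=> x _; rewrite lee_fin sqr_ge0.
by rewrite leeDl // integral_ge0 // => x _; rewrite lee_fin sqr_ge0.
Qed.

Lemma spectral_integrable u : dom A u -> (mu u).-integrable setT (fun x : T => (f x)%:E).
Proof.
case: hA => _ -> _ /= fu.
have i1 : (mu u).-integrable setT (fun x : T => ((f x) ^+ 2)%:E).
  apply/integrableP; split; first exact: measurable_sqr_EFin.
  rewrite (eq_integral (fun x : T => ((f x) ^+ 2)%:E)) // => x _.
  by rewrite gee0_abs // lee_fin sqr_ge0.
have i2 := spectral_integrable_cst u 1.
apply: le_integrable (integrableD measurableT i1 i2) => //.
  exact/measurable_EFinP.
move=> x _; rewrite /= lee_fin [leRHS]ger0_norm ?addr_ge0 ?sqr_ge0 //.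
(* This square gives |f| <= f^2 + 1, and constants are integrable because the measure is finite. *)
have := sqr_ge0 (`|f x| - 1); rewrite sqrrB real_normK ?num_real //.
have := normr_ge0 (f x); move: (`|f x|) (f x ^+ 2) => a b; lra.
Qed.

Lemma spectral_ip u : dom A u -> ip (A u) u = fine (\int[mu u]_x (f x)%:E).
Proof. by case: hA => _ _ h Au; rewrite /ip h. Qed.

Lemma spectral_ip_split u X : measurable X -> dom A u ->
  ip (A u) u = ip (A (E X u)) (E X u) + ip (A (E (~` X) u)) (E (~` X) u).
Proof.
move=> mX Au; have mXC := measurableC mX.
have A1 := spectral_dom_proj mX Au; have A2 := spectral_dom_proj mXC Au.
rewrite !spectral_ip // -fineD ?integrable_fin_num //; do ?exact: spectral_integrable.
congr fine; rewrite -integral_measure_add //; do ?exact: spectral_integrable.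
apply: eq_measure_integral => Y mY _.
exact: eq_trans (spectral_measure_split u mX mY) (esym (measure_addE _ _ _)).
Qed.

(** The quadratic form is given by a real integral, and a real form is symmetric: expand it at u + i
    v. *)
Lemma spectral_sym u v : dom A u -> dom A v -> ip (A u) v = ip u (A v).
Proof.
have lA := spectral_integral_linear.
have im0 w : dom A w -> ip (A w) ('i%C *: w) = 0.
  case: hA => _ _ h Aw; have := h w Aw.
  rewrite (dotE dot) => /(congr1 (@complex.Im R)) /=.
  by rewrite !(mul0r, mul1r, mulr0, add0r, addr0, subr0).
move=> Au Av; have [Aiv Eiv] := operatorZi 'i%C lA Av.
have [Aw Ew] := operatorD lA Au Aiv.
have := im0 _ Aw; rewrite Ew Eiv scalerDr scalerA.
have -> : ('i%C * 'i%C : R[i]) = -1 by rewrite -expr2 sqr_i.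
rewrite scaleN1r !ipE !(ip_i dot) (im0 u Au) !(ip_iC dot) (im0 v Av) => h.
by rewrite (ipC dot u); lra.
Qed.

(** The form at u + E(~X) v splits without cross terms, so by symmetry A u is orthogonal to E(~X) v
    for all v in a dense set. *)
Lemma spectral_invariant u X : dense (dom A) -> measurable X -> dom A u -> E X u = u ->
  E X (A u) = A u.
Proof.
move=> dA mX Au Xu; have mXC := measurableC mX.
have lA := spectral_integral_linear.
suff h : E (~` X) (A u) = 0 by rewrite [RHS](pvm_compl (A u) mX) h addr0.
apply: (dense_ip_eq0 hH dA) => v Av; rewrite (pvm_sym hE) //.
have Av2 := spectral_dom_proj mXC Av.
have [Aw Ew] := operatorD lA Au Av2.
have e1 : E X (E (~` X) v) = 0 by rewrite -(pvmI hE) // setICr (pvm_set0 hE).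
have e2 : E (~` X) u = 0 by rewrite -Xu -(pvmI hE) // setICl (pvm_set0 hE).
have := spectral_ip_split mX Aw.
rewrite !(pvmD hE) // Xu e1 e2 (pvmK hE) // addr0 add0r Ew !ipE.
by rewrite (spectral_sym Av2 Au) (ipC dot _ (A u)); lra.
Qed.

Lemma le_spectral_integral u X (g h : T -> R) : measurable X -> E X u = u ->
  (mu u).-integrable setT (EFin \o g) -> (mu u).-integrable setT (EFin \o h) ->
  (forall x, X x -> g x <= h x) ->
  fine (\int[mu u]_x (g x)%:E) <= fine (\int[mu u]_x (h x)%:E).
Proof.
move=> mX Xu ig ih gh; have mXC := measurableC mX.
rewrite -lee_fin !fineK ?integrable_fin_num //.
rewrite (negligible_integral mXC) //; last exact: spectral_measure_out.
rewrite [leRHS](negligible_integral mXC) //; last exact: spectral_measure_out.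
rewrite setTD setCK; apply: le_integral => //.
- exact: integrableS ig.
- exact: integrableS ih.
- by move=> x; rewrite inE => /gh; rewrite lee_fin.
Qed.

Lemma spectral_ip_le u X (b : R) : measurable X -> dom A u -> E X u = u ->
  (forall x, X x -> f x <= b) -> ip (A u) u <= b * nr u ^+ 2.
Proof.
move=> mX Au Xu fb; rewrite spectral_ip //.
have := le_spectral_integral mX Xu (spectral_integrable Au) (spectral_integrable_cst u b) fb.
by move/le_trans; apply; rewrite integral_spectral_cst.
Qed.

Lemma spectral_ip_ge u X (b : R) : measurable X -> dom A u -> E X u = u ->
  (forall x, X x -> b <= f x) -> b * nr u ^+ 2 <= ip (A u) u.
Proof.
move=> mX Au Xu fb; rewrite spectral_ip //.
have := le_spectral_integral mX Xu (spectral_integrable_cst u b) (spectral_integrable Au) fb.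
by apply: le_trans; rewrite integral_spectral_cst.
Qed.

Lemma spectral_dom_bounded u X (M : R) : measurable X -> E X u = u ->
  (forall x, X x -> `|f x| <= M) -> dom A u.
Proof.
move=> mX Xu fM; case: hA => _ -> _ /=; have mXC := measurableC mX.
rewrite -[X in (X < _)%E]/(\int[mu u]_x ((f x) ^+ 2)%:E)%E.
apply: (@le_lt_trans _ _ (\int[mu u]_x (M ^+ 2)%:E)%E); last first.
  by rewrite integral_spectral_cst ltry.
apply: ae_ge0_le_integral => //.
- by move=> x _; rewrite lee_fin sqr_ge0.
- exact: measurable_sqr_EFin.
- by move=> x _; rewrite lee_fin sqr_ge0.
exists (~` X); split => //; first exact: spectral_measure_out.
move=> x /= h Xx; apply: h => _; rewrite lee_fin -(real_normK (num_real (f x))).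
by rewrite lerXn2r ?nnegrE ?fM // (le_trans _ (fM x Xx)).
Qed.

(** On the range of E(X) the form of A - m is at most d in absolute value. For a symmetric operator
    the form bound is a norm bound by polarization, with no need to compose operators. *)
Lemma spectral_scalar_approx u X (M m d : R) : dense (dom A) -> measurable X -> 0 < d ->
  (forall x, X x -> `|f x| <= M) -> (forall x, X x -> `|f x - m| <= d) ->
  E X u = u -> nr (A u - m%:C *: u) <= d * nr u.
Proof.
move=> dA mX d0 fM fm Xu; have lA := spectral_integral_linear.
have Adom v : E X v = v -> dom A v by move=> Xv; apply: spectral_dom_bounded fM.
have [w wdef] : exists w, w = A u - m%:C *: u by eexists.
rewrite -wdef.
have Xw : E X w = w.
  rewrite wdef -scaleN1r; have := pvm_lin hE (-1) (A u) (m%:C *: u) mX.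
  rewrite rmorphN1 => ->; rewrite spectral_invariant //; last exact: Adom.
  by have := pvm_lin hE m 0 u mX; rewrite !add0r (pvm0 hE) // add0r Xu => ->.
have q v : E X v = v -> `|ip (A v) v - m * nr v ^+ 2| <= d * nr v ^+ 2.
  move=> Xv; have Av := Adom v Xv.
  have h1 : ip (A v) v <= (m + d) * nr v ^+ 2.
    by apply: spectral_ip_le Xv _ => // x /fm; rewrite ler_distl => /andP[].
  have h2 : (m - d) * nr v ^+ 2 <= ip (A v) v.
    by apply: spectral_ip_ge Xv _ => // x /fm; rewrite ler_distl => /andP[].
  by rewrite ler_norml; apply/andP; split; lra.
have Xs s : E X (u + s%:C *: w) = u + s%:C *: w by rewrite (pvm_lin hE) // Xu Xw.
have Au := Adom u Xu; have Aw := Adom w Xw.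
have sym := spectral_sym Aw Au.
have wE : ip (A u) w - m * ip u w = nr w ^+ 2.
  have wv v : ip w v = ip (A u) v - m * ip u v by rewrite wdef !ipE.
  by rewrite -(ipxx hH) wv.
(* Subtracting the form bounds at u + w / d and u - w / d leaves |w|^2 / d <= d |u|^2; the factor 1
   / d balances the two sides. *)
have := q _ (Xs d^-1); have := q _ (Xs (- d^-1)).
have [_ ->] := operator_lin d^-1 lA Au Aw.
have [_ ->] := operator_lin (- d^-1) lA Au Aw.
rewrite -!(ipxx hH) !ipE (ipC dot w u) sym (ipC dot w (A u)).
rewrite !ler_norml => /andP[h1 _] /andP[_ h2].
have dV : d * d^-1 = 1 by rewrite divff // gt_eqF.
have dV0 : 0 < d^-1 by rewrite invr_gt0.
have uu := ipxx hH u; have ww := ipxx hH w.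
have : nr w ^+ 2 <= (d * nr u) ^+ 2.
  rewrite -ww exprMn -uu; move: h1 h2 wE uu ww dV dV0.
  move: (ip u u) (ip w w) (ip u w) (ip (A u) w) (ip (A u) u) (ip (A w) w) (d^-1).
  move=> U W P Q AU AW D h1 h2 wE uu ww dV dV0.
  have e1 : d * (D * (D * W)) = D * W by rewrite (mulrA d D) dV mul1r.
  have e2 : D * Q - m * (D * P) = D * W by rewrite ww -wE; ring.
  have : D * W <= d * U by lra.
  move=> h; have -> : W = d * (D * W) by rewrite mulrA [d * D]dV mul1r.
  by rewrite expr2 -mulrA ler_wpM2l // ltW.
by rewrite ler_sqr ?nnegrE ?mulr_ge0 ?nr_ge0 // ltW.
Qed.

End OneMeasure.
End SpectralIntegral.

(** * Positive spectrum cut into slabs *)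

Section SpectralSteps.
Variables (R : realType) (H : completeNormedModType R[i]).
Variable dot : {dot H for Num.conj}.
Hypothesis hH : hilbert_norm dot.
Local Notation ip := (re_dot dot).
Implicit Types (u v w : H).
Local Notation T := (measurableTypeR R).
Local Notation pvm := (projection_valued_measure dot).

(** The absolute value lets slabs indexed by [nat] cover the whole line; negative points are
    discarded afterwards, by positivity. *)
Definition step_set (e : R) (k : nat) : set T :=
  [set x : T | k%:R * e <= `|x : R| < k.+1%:R * e].

Lemma measurable_step_set e k : measurable (step_set e k).
Proof.
rewrite (_ : step_set e k = setT `&` (@Num.Def.normr R R : T -> R) @^-1` `[k%:R * e, k.+1%:R * e[%classic).
  by apply: normr_measurable => //; exact: measurable_itv.
by apply/seteqP; split => x /=; rewrite in_itv /=; [|case].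
Qed.

Lemma trivIset_step_set e : 0 < e -> trivIset setT (step_set e).
Proof.
move=> e0 i j _ _ [x [/andP[i1 i2] /andP[j1 j2]]].
have := le_lt_trans i1 j2; have := le_lt_trans j1 i2.
by rewrite !ltr_pM2r // !ltr_nat !ltnS => ij ji; apply/eqP; rewrite eqn_leq ij ji.
Qed.

Lemma bigcup_step_set e : 0 < e -> \bigcup_k step_set e k = setT.
Proof.
move=> e0; apply/seteqP; split => // x _.
exists (Num.truncn (`|x : R| / e)) => //.
have : 0 <= `|x : R| / e by rewrite divr_ge0 // ltW.
by move/truncn_itv; rewrite ler_pdivlMr // ltr_pdivrMr.
Qed.

Definition nonneg_set : set T := [set x | 0 <= (x : R)].

Lemma measurable_nonneg_set : measurable nonneg_set.
Proof.
rewrite (_ : nonneg_set = `[0, +oo[%classic); first exact: measurable_itv.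
by apply/seteqP; split => x /=; rewrite in_itv /= andbT.
Qed.

(** On the range of the projection onto negative spectrum the form is at most 0, so that range is
    trivial by strict positivity. *)
Lemma spectral_nonneg E (hE : pvm E) (A : operator H) : dense (dom A) ->
  spectral_integral dot E id A -> (forall u, dom A u -> ip (A u) u <= 0 -> u = 0) ->
  forall u, E nonneg_set u = u.
Proof.
move=> dA hA pA u; have mN := measurable_nonneg_set; have mNC := measurableC mN.
have mid : measurable_fun (setT : set T) (id : T -> R) by exact: measurable_id.
suff h : E (~` nonneg_set) u = 0 by rewrite [RHS](pvm_compl hH hE u mN) h addr0.
apply: (dense_ip_eq0 hH dA) => v Av; rewrite (pvm_sym hE) //.
suff -> : E (~` nonneg_set) v = 0 by rewrite ip0r.
apply: pA; first exact: (spectral_dom_proj hH hE mid hA mNC Av).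
rewrite -[leRHS](mul0r (nr (E (~` nonneg_set) v) ^+ 2)).
apply: (spectral_ip_le hH hE mid hA mNC); first exact: (spectral_dom_proj hH hE mid hA mNC Av).
  exact: (pvmK hE).
by move=> x /negP; rewrite -ltNge => /ltW.
Qed.

Lemma expR_lip (a b : R) : 0 <= a -> a <= b -> 0 <= expR (- a) - expR (- b) <= b - a.
Proof.
move=> a0 ab; rewrite subr_ge0 ler_expR lerN2 ab /=.
have -> : - b = - a + - (b - a) by ring.
rewrite expRD -[X in X - _]mulr1 -mulrBr.
have h1 : expR (- a) <= 1 by rewrite -expR0 ler_expR oppr_le0.
have := expR_ge1Dx (- (b - a)) => h2.
have h3 : expR (- (b - a)) <= 1 by rewrite -expR0 ler_expR oppr_le0 subr_ge0.
have h4 : 0 <= 1 - expR (- (b - a)) by rewrite subr_ge0.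
by apply: le_trans (ler_wpM2r h4 h1) _; lra.
Qed.

(* On each spectral slab [k e <= x < (k + 1) e] the operator and its heat flow are *)
(* nearly scalar, so finite sums of slabs behave like eigenvector expansions. *)
Lemma spectral_steps (A : operator H) (h : H -> H) (t e : R) : 0 < t -> 0 < e ->
  dense (dom A) -> (forall u, dom A u -> ip (A u) u <= 0 -> u = 0) ->
  functional_calculus dot A (fun x => expR (- t * x)) (everywhere h) ->
  exists P : nat -> H -> H,
  [/\ forall k u, [/\ dom A (P k u), P k (P k u) = P k u,
        P k (A (P k u)) = A (P k u) & P k (h (P k u)) = h (P k u)],
      forall k (a : R) u v, P k (u + a%:C *: v) = P k u + a%:C *: P k v,
      forall j k u v, ip (P j u) (P k v) = if j == k then ip (P j u) v else 0,
      forall k u, nr (A (P k u) - (k%:R * e)%:C *: P k u) <= e * nr (P k u) /\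
        nr (h (P k u) - (expR (- t * (k%:R * e)))%:C *: P k u) <= t * e * nr (P k u) &
      linear h /\ (forall u v, ip (h u) v = ip u (h v)) /\
      forall u, \sum_(0 <= k < n) P k u @[n --> \oo] --> u].
Proof.
move=> t1 e0 dA pA [E [hE hA hh]].
pose P k := E (step_set e k); exists P; have t0 := ltW t1.
have mS k : measurable (step_set e k) by exact: measurable_step_set.
have mN := measurable_nonneg_set.
have pos u : E nonneg_set u = u by apply: spectral_nonneg hA pA _.
(* The same projection as [step_set e k], but on this set x >= 0, so exp(- t x) <= 1 and the
   exponential is Lipschitz with constant t. *)
pose X k := step_set e k `&` nonneg_set.
have mX k : measurable (X k) by exact: measurableI.
have PX k u : P k u = E (X k) u by rewrite /X (pvmI hE) // pos.
have mid : measurable_fun (setT : set T) (id : T -> R) by exact: measurable_id.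
have mexp : measurable_fun (setT : set T) ((fun x : R => expR (- t * x)) : T -> R).
  apply: measurableT_comp; first exact: measurable_expR.
  by apply: measurable_funM.
have XE k (x : R) : X k x -> k%:R * e <= x < k.+1%:R * e by move=> [+ /ger0_norm x0]; rewrite /step_set /= x0.
have b1 k (x : R) : X k x -> `|id x| <= k.+1%:R * e.
  by move=> Xx; have /andP[_ /ltW] := XE k x Xx; case: Xx => _ /ger0_norm ->.
have b2 k (x : R) : X k x -> `|id x - k%:R * e| <= e.
  move=> /XE/andP[h1 h2]; rewrite ger0_norm ?subr_ge0 //.
  by move: h2; rewrite -natr1 => h2 /=; lra.
have b3 k (x : R) : X k x -> `|expR (- t * x)| <= 1.
  move=> [_ x0]; rewrite ger0_norm ?expR_ge0 // -expR0 ler_expR mulNr oppr_le0.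
  by rewrite mulr_ge0.
have b4 k (x : R) : X k x -> `|expR (- t * x) - expR (- t * (k%:R * e))| <= t * e.
  move=> Xx; have /andP[h1 h2] := XE k x Xx.
  have [/andP[h3 h4]] : 0 <= expR (- (t * (k%:R * e))) - expR (- (t * x)) <= t * x - t * (k%:R * e).
    by apply: expR_lip; [rewrite !mulr_ge0 // ltW|rewrite ler_wpM2l].
  rewrite !mulNr distrC ger0_norm //; apply: le_trans h4 _.
  by rewrite -mulrBr ler_wpM2l //; move: h2; rewrite -natr1; lra.
have dT : dense (dom (everywhere h)) by move=> O [x Ox] _; exists x.
have PK k u : E (X k) (P k u) = P k u by rewrite PX (pvmK hE).
have Pdom k u : dom A (P k u) by apply: (spectral_dom_bounded hH hE mid hA (mX k)) (PK k u) (b1 k).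
split.
- move=> k u; split => //; first exact: (pvmK hE).
    rewrite [LHS]PX; exact: (spectral_invariant hH hE mid hA).
  rewrite [LHS]PX.
  exact: (spectral_invariant hH hE mexp hh).
- by move=> k a u v; apply: (pvm_lin hE).
- move=> j k u v; rewrite /P -(pvm_sym hE) // -(pvmI hE) //.
  case: eqVneq => [->|jk]; first by rewrite setIid.
  have /trivIsetP/(_ k j) -> := trivIset_step_set e0; rewrite ?(pvm_set0 hE) ?ip0l //.
  by rewrite eq_sym.
- move=> k u; split.
    exact: (spectral_scalar_approx hH hE mid hA dA (mX k) e0 (b1 k) (b2 k) (PK k u)).
  exact: (spectral_scalar_approx hH hE mexp hh dT (mX k) (mulr_gt0 t1 e0) (b3 k) (b4 k) (PK k u)).
- split; [|split].
  + move=> a u v; have [_ /(_ a u v I I)[]] := spectral_integral_linear hh; done.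
  + by move=> u v; have := spectral_sym hh (u := u) (v := v) I I.
  + move=> u; have := pvm_sigma hE (u := u) mS (trivIset_step_set e0).
    by rewrite bigcup_step_set // (pvm_setT hE).
Qed.

End SpectralSteps.

(** * Semigroups and classical solutions *)

Section MeanValue.
Variable R : realType.

Lemma rder_ext (F G : R -> R) (t a : R) : 0 <= t -> (forall r, 0 <= r -> F r = G r) ->
  rder F t a -> rder G t a.
Proof.
move=> t0 FG hF e e0; have h0 := half_line_ge0 t; have h1 := hF e e0.
apply: filterS2 h0 h1 => r r0.
by rewrite !FG.
Qed.

Lemma rder_mvt_le (F F' : R -> R) (a b K : R) : 0 <= a -> a <= b ->
  (forall t, a <= t <= b -> rder F t (F' t)) ->
  (forall t, a <= t <= b -> F' t <= K) -> F b - F a <= K * (b - a).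
Proof.
move=> a0 ab hF hK.
have : F b + - K * b <= F a + - K * a.
  apply: (@rder_le0_nincr _ (fun r => F r + - K * r) (fun r => F' r + - K * 1)) => // t tab.
    by apply: rderD; [exact: hF|apply: rder_scale; exact: rder_id].
  by rewrite mulr1 subr_le0 hK.
by lra.
Qed.

Lemma rder_mvt (F F' : R -> R) (a b K : R) : 0 <= a -> a <= b ->
  (forall t, a <= t <= b -> rder F t (F' t)) ->
  (forall t, a <= t <= b -> `|F' t| <= K) -> `|F b - F a| <= K * (b - a).
Proof.
move=> a0 ab hF hK; rewrite ler_norml; apply/andP; split; last first.
  by apply: (rder_mvt_le a0 ab hF) => t /hK; apply: le_trans; exact: ler_norm.
have : -1 * F b - -1 * F a <= K * (b - a).
  apply: (@rder_mvt_le (fun r => -1 * F r) (fun r => -1 * F' r)) => // t tab.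
    by apply: rder_scale; exact: hF.
  by rewrite mulN1r; apply: le_trans (hK t tab); rewrite -normrN; exact: ler_norm.
by lra.
Qed.

Lemma nr_fst (V W : normedModType R[i]) (z : V * W) : nr z.1 <= nr z.
Proof. by rewrite -lecR -[(nr z)%:C]nrE prod_normE !nrE /Order.max ltcR; case: ltP; rewrite lecR // => /ltW. Qed.

Lemma nr_snd (V W : normedModType R[i]) (z : V * W) : nr z.2 <= nr z.
Proof. by rewrite -lecR -[(nr z)%:C]nrE prod_normE !nrE /Order.max ltcR; case: ltP; rewrite lecR. Qed.

Lemma nr_pair (V W : normedModType R[i]) (z : V * W) (K : R) :
  nr z.1 <= K -> nr z.2 <= K -> nr z <= K.
Proof.
move=> h1 h2; rewrite -lecR -nrE prod_normE !nrE.
by rewrite /Order.max; case: ifP; rewrite lecR.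
Qed.

End MeanValue.

Section Semigroup.
Variables (R : realType) (H H1 : completeNormedModType R[i]).
Variable U : R -> H1 * H -> H1 * H.
Hypothesis hU : contraction_semigroup U.
Implicit Types (z w : H1 * H) (s t : R).

Lemma semigroupB t z w : 0 <= t -> U t (z - w) = U t z - U t w.
Proof.
move=> t0; case: hU => /(_ t t0) lin _ _ _ _.
by rewrite -scaleN1r addrC lin scaleN1r addrC.
Qed.

Lemma semigroupZ t (c : R[i]) z : 0 <= t -> U t (c *: z) = c *: U t z.
Proof.
move=> t0; have U0 : U t 0 = 0 by have := semigroupB 0 0 t0; rewrite !subrr.
by case: hU => /(_ t t0 c z 0) + _ _ _ _; rewrite U0 !addr0.
Qed.

(** The factor 2 pays for passing between the max norm and the sum of squares. *)
Lemma semigroup_nr t z : 0 <= t -> nr (U t z) <= 2 * nr z.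
Proof.
move=> t0; case: hU => _ _ _ _ /(_ t z t0).
rewrite !nrE -!rmorphXn -!rmorphD /= lecR => h.
have h1 := nr_fst z; have h2 := nr_snd z.
have n0 := nr_ge0 z; have n1 := nr_ge0 z.1; have n2 := nr_ge0 z.2.
have h3 : nr z.1 ^+ 2 + nr z.2 ^+ 2 <= (2 * nr z) ^+ 2 by nra.
have m1 := sqr_ge0 (nr (U t z).1); have m2 := sqr_ge0 (nr (U t z).2).
apply: nr_pair; rewrite -ler_sqr ?nnegrE ?nr_ge0 ?mulr_ge0 //; lra.
Qed.

Lemma semigroup_cont z (e : R) : 0 < e ->
  exists2 d : R, 0 < d & forall s, 0 < s -> s < d -> nr (U s z - z) <= e.
Proof.
move=> e0; case: hU => _ _ _ /(_ z) /cvg_nr/(_ e e0) [d /= d0 hd] _.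
exists d => // s s0 sd; apply/ltW/hd => //=.
by rewrite sub0r normrN gtr0_norm.
Qed.

Lemma semigroup_der0 z w (e : R) : (t^-1)%:C *: (U t z - z) @[t --> 0^'+] --> w ->
  0 < e -> exists2 d : R, 0 < d &
    forall s, 0 < s -> s < d -> nr (U s z - z - s%:C *: w) <= e * s.
Proof.
move=> + e0 => /cvg_nr/(_ e e0) [d /= d0 hd]; exists d => // s s0 sd.
have /ltW : nr ((s^-1)%:C *: (U s z - z) - w) < e.
  by apply: hd => //=; rewrite sub0r normrN gtr0_norm.
have -> : U s z - z - s%:C *: w = s%:C *: ((s^-1)%:C *: (U s z - z) - w).
  by rewrite scalerBr scalerA -rmorphM divff ?gt_eqF // scale1r.
by rewrite nrZ gtr0_norm // mulrC ler_pM2r.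
Qed.

Lemma semigroup_hder z w t : 0 <= t -> (r^-1)%:C *: (U r z - z) @[r --> 0^'+] --> w ->
  hder (U^~ z) t (U t w).
Proof.
move=> t0 zw e e0; have [_ U0 UD _ _] := hU.
have e4 : 0 < e / 4 by rewrite divr_gt0.
have [d1 d10 h1] := semigroup_der0 zw e4.
have [d2 d20 h2] := semigroup_cont w e4.
have d0 : 0 < Num.min d1 d2 by rewrite lt_min d10.
near=> r.
have r0 : 0 <= r by near: r; exact: half_line_ge0.
have : `|r - t| < Num.min d1 d2 by near: r; exact: half_line_near.
rewrite lt_min => /andP[rd1 rd2].
have [rt|tr|<-] := ltrgtP r t; last first.
- by rewrite !subrr rmorph0 scale0r subrr nr0 mulr0.
- have s0 : 0 < r - t by rewrite subr_gt0.
  rewrite (gtr0_norm s0) in rd1 rd2.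
  have -> : U r z - U t z - (r - t)%:C *: U t w = U t (U (r - t) z - z - (r - t)%:C *: w).
    have trE : t + (r - t) = r by ring.
    by rewrite !semigroupB // semigroupZ // -UD // ?(ltW s0) // trE.
  rewrite (le_trans (semigroup_nr _ t0)) //.
  by have := h1 _ s0 rd1; nra.
(* To the left of t everything is factored through [U r]. This trades [U t w] for [U r w], at a cost
   controlled by strong continuity at w; with the factor 2 each error is at most e / 2. *)
- have s0 : 0 < t - r by rewrite subr_gt0.
  rewrite (distrC r) (gtr0_norm s0) in rd1 rd2.
  have Ut v : U t v = U r (U (t - r) v) by rewrite -UD ?(ltW s0) // (_ : r + (t - r) = t) //; ring.
  have -> : U r z - U t z - (r - t)%:C *: U t w =
     (t - r)%:C *: U r (U (t - r) w - w) - U r (U (t - r) z - z - (t - r)%:C *: w).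
    rewrite !semigroupB // semigroupZ // -!Ut scalerBr.
    rewrite [- (U t z - _ - _)]opprB [- (U t z - _)]opprB addrA subrK [RHS]addrC.
    by rewrite -[r - t]opprB rmorphN scaleNr opprK.
  apply: le_trans (nrB _ _) _; rewrite nrZ gtr0_norm //.
  have y1 := semigroup_nr (U (t - r) z - z - (t - r)%:C *: w) r0.
  have y2 := semigroup_nr (U (t - r) w - w) r0.
  have y3 := h1 _ s0 rd1; have y4 := h2 _ s0 rd2.
  have y5 : nr (U r (U (t - r) w - w)) <= 2 * (e / 4) by lra.
  have := ler_wpM2l (ltW s0) y5; lra.
Unshelve. all: by end_near. Qed.

Lemma semigroup_generator z w t : 0 <= t ->
  (r^-1)%:C *: (U r z - z) @[r --> 0^'+] --> w ->
  (r^-1)%:C *: (U r (U t z) - U t z) @[r --> 0^'+] --> U t w.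
Proof.
move=> t0 zw; apply/cvg_nr => e e0; have [_ _ UD _ _] := hU.
have e4 : 0 < e / 4 by rewrite divr_gt0.
have [d d0 h] := semigroup_der0 zw e4.
near=> s.
have s0 : 0 < s by near: s; exact: nbhs_right_gt.
have sd : s < d by near: s; exact: nbhs_right_lt.
have -> : (s^-1)%:C *: (U s (U t z) - U t z) - U t w =
    (s^-1)%:C *: U t (U s z - z - s%:C *: w).
  rewrite !semigroupB // semigroupZ // -!UD // ?(ltW s0) // (addrC s) [in RHS]scalerBr.
  by rewrite scalerA -rmorphM mulVf ?gt_eqF // scale1r.
rewrite nrZ gtr0_norm ?invr_gt0 // mulrC ltr_pdivrMr //.
have := semigroup_nr (U s z - z - s%:C *: w) t0; have := h s s0 sd.
by nra.
Unshelve. all: by end_near. Qed.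

End Semigroup.

(** * Classical solutions of the damped wave equation from the semigroup *)

Section ClassicalSolutions.
Variables (R : realType) (H H1 : completeNormedModType R[i]).
Variables (dot : {dot H for Num.conj}) (dot1 : {dot H1 for Num.conj}).
Hypotheses (hH : hilbert_norm dot) (hH1 : hilbert_norm dot1).
Variables (A S : operator H) (B : H -> H) (j : H -> H1).
Hypotheses (A_sa : self_adjoint dot A) (A_pos : positive dot A).
Hypotheses (hS : is_sqrt dot A S) (hj : energy_completion A S j).
Variable U : R -> H1 * H -> H1 * H.
Hypotheses (hU : contraction_semigroup U)
  (U_gen : has_generator U (damped_wave_graph dot dot1 A S B j)).
Local Notation ip := (re_dot dot).
Local Notation ip1 := (re_dot dot1).
Local Notation graph := (damped_wave_graph dot dot1 A S B j).

Lemma sqrt_linear : linear_operator S. Proof. by case: hS => -[]. Qed.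

Lemma dom_sqrt u : dom A u -> dom S u.
Proof. by case: hS => _ _ -> _ []. Qed.

Lemma embed_lin (a : R) u v : dom S u -> dom S v -> j (u + a%:C *: v) = j u + a%:C *: j v.
Proof. by move=> Su Sv; case: hj => h _ _; rewrite addrC h // addrC. Qed.

Lemma embedZi u : dom S u -> j ('i%C *: u) = 'i%C *: j u.
Proof.
move=> Su; have S0 := sqrt_linear.1; have j0 : j 0 = 0.
  by have := embed_lin (-1) S0 S0; rewrite rmorphN1 !scaleN1r !subrr.
by case: hj => /(_ 'i%C u 0 Su S0) + _ _; rewrite j0 !addr0.
Qed.

Lemma embed_ip u v : dom S u -> dom S v -> ip1 (j u) (j v) = ip (S u) (S v).
Proof.
move=> Su Sv; case: hj => _ nj _.
have nrj w : dom S w -> nr (j w) = nr (S w) by move=> Sw; apply: complexI; rewrite -!nrE nj.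
have [Suv Euv] := operatorD sqrt_linear Su Sv.
have := nrj _ Suv; have := nrj u Su; have := nrj v Sv.
have := embed_lin 1 Su Sv; rewrite !scale1r Euv => ->.
move=> /(congr1 (fun x => x ^+ 2)) + /(congr1 (fun x => x ^+ 2)) + /(congr1 (fun x => x ^+ 2)).
by rewrite -!(ipxx hH1) -!(ipxx hH) !ipE (ipC dot1 (j v)) (ipC dot (S v) (S u)); lra.
Qed.

Lemma sqrt_ip u v : dom A u -> dom S v -> ip (S u) (S v) = ip (A u) v.
Proof.
case: hS => S_sa _ dA E Au Sv; have [Su SSu] : dom S u /\ dom S (S u) by move: Au; rewrite dA.
by rewrite -(self_adjoint_sym S_sa SSu Sv) E.
Qed.

Lemma embed_ip_dom u v : dom A u -> dom S v -> ip1 (j u) (j v) = ip (A u) v.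
Proof. by move=> Au Sv; rewrite embed_ip ?sqrt_ip //; exact: dom_sqrt. Qed.

Lemma extension_eq_dom u : dom A u -> extension_eq dot dot1 A j (j u) (A u).
Proof.
move=> Au v Av; have [Aiv _] := operatorZi 'i%C (let: And3 l _ _ := A_sa in l) Av.
by rewrite (dotE dot1) (dotE dot) -embedZi ?embed_ip_dom //; exact: dom_sqrt.
Qed.

(** For a vector of H1 coming from D(S), the weak equation is a statement about the adjoint of A, so
    self-adjointness turns it into membership in D(A). *)
Lemma extension_eq_inv u f : dom S u -> extension_eq dot dot1 A j (j u) f ->
  dom A u /\ A u = f.
Proof.
move=> Su h; apply: (self_adjoint_dom (dot := dot)) => // v Av.
rewrite -embed_ip_dom // (ipC dot1) (ipC dot v) /re_dot.
by congr complex.Re; apply: h.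
Qed.

Lemma hder_fst (f : R -> H1 * H) t d : hder f t d -> hder (fst \o f) t d.1.
Proof. by apply: (@hder_lin _ _ _ _ 1) => // v; rewrite mul1r nr_fst. Qed.

Lemma hder_snd (f : R -> H1 * H) t d : hder f t d -> hder (snd \o f) t d.2.
Proof. by apply: (@hder_lin _ _ _ _ 1) => // v; rewrite mul1r nr_snd. Qed.

Lemma hder_lipschitz (f f' : R -> H) (a b K : R) : 0 <= a -> a <= b ->
  (forall t, a <= t <= b -> hder f t (f' t)) -> (forall t, a <= t <= b -> nr (f' t) <= K) ->
  nr (f b - f a) <= K * (b - a).
Proof.
move=> a0 ab hf hK; have K0 : 0 <= K by apply: le_trans (nr_ge0 _) (hK a _); rewrite lexx.
apply: (nr_le_pairing hH) => [|w]; first by rewrite mulr_ge0 // subr_ge0.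
rewrite ipDl ipNl mulrAC.
apply: (@rder_mvt_le _ (fun t => ip (f t) w) (fun t => ip (f' t) w + ip (f t) 0)) => // t tab.
  by apply: rder_ip => //; [exact: hf|exact: hder_cst].
rewrite ip0r addr0; apply: le_trans (ip_le hH _ _) _.
by rewrite ler_wpM2r ?nr_ge0 // hK.
Qed.

(** The range of A is dense, although 0 may lie in the spectrum, so no bound on an inverse of A
    enters. *)
Lemma nr_le_dense_pairing v (K : R) : 0 <= K ->
  (forall u, dom A u -> `|ip v (A u)| <= K * nr (A u)) -> nr v <= K.
Proof.
move=> K0 h; apply: (nr_le_pairing hH) => // w.
apply: (@ler_addMgt0 _ _ _ (nr v + K)) => [|e e0]; first by rewrite addr_ge0 ?nr_ge0.
have [u Au uw] := dense_range hH w A_sa A_pos e0.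
have -> : ip v w = ip v (A u) + ip v (w - A u) by rewrite !ipE; ring.
have h1 := le_trans (ler_norm _) (h u Au).
have h2 := le_trans (ip_le hH v (w - A u)) (ler_wpM2l (nr_ge0 v) (ltW uw)).
have h3 : nr (A u) <= nr w + e.
  rewrite -[A u](subrK w) addrC (le_trans (nrD _ _)) // lerD2l nrBC; exact: ltW.
have := ler_wpM2l K0 h3; lra.
Qed.

(* The H1-valued derivative of j(h) only controls h against the range of A; *)
(* the quadratic remainder is what survives the passage to all of H. *)
Lemma hder_weak (h h1 : R -> H) (K : R) : 
  (forall t, 0 <= t -> nr (h1 t) <= K) ->
  (forall r s, 0 <= r -> 0 <= s -> nr (h1 r - h1 s) <= K * `|r - s|) ->
  (forall t u, 0 <= t -> dom A u -> rder (fun r => ip (h r) (A u)) t (ip (h1 t) (A u))) ->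
  forall t, 0 <= t -> hder h t (h1 t).
Proof.
move=> bK lK hw t t0 e e0.
have K0 : 0 <= K by apply: le_trans (nr_ge0 _) (bK t t0).
have main r : 0 <= r -> nr (h r - h t - (r - t)%:C *: h1 t) <= K * `|r - t| * `|r - t|.
  move=> r0; apply: nr_le_dense_pairing => [|u Au]; first by rewrite !mulr_ge0.
  pose F s := ip (h s) (A u) + - (ip (h1 t) (A u)) * s.
  have dF s : 0 <= s -> rder F s (ip (h1 s) (A u) + - (ip (h1 t) (A u)) * 1).
    by move=> s0; apply: rderD; [exact: hw|apply: rder_scale; exact: rder_id].
  have FE x y : F x - F y = ip (h x - h y - (x - y)%:C *: h1 t) (A u).
    by rewrite /F !ipE; ring.
  have bF s : 0 <= s -> `|s - t| <= `|r - t| ->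
      `|ip (h1 s) (A u) + - (ip (h1 t) (A u)) * 1| <= K * `|r - t| * nr (A u).
    move=> s0 srt; rewrite mulr1 -ipNl -ipDl (le_trans (ip_norm_le hH _ _)) //.
    rewrite ler_wpM2r ?nr_ge0 // (le_trans (lK _ _ s0 t0)) //.
    by rewrite ler_wpM2l.
  rewrite -FE; have [rt|/ltW tr] := leP r t.
    rewrite distrC [leRHS]mulrAC.
    have rtE : `|r - t| = t - r by rewrite distrC ger0_norm // subr_ge0.
    rewrite [X in _ <= _ * X]rtE.
    apply: (rder_mvt r0 rt) => s /andP[rs st]; first by apply: dF; lra.
    apply: bF; first by lra.
    by rewrite rtE distrC ger0_norm; lra.
  rewrite [leRHS]mulrAC.
  have rtE : `|r - t| = r - t by rewrite ger0_norm // subr_ge0.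
  rewrite [X in _ <= _ * X]rtE.
  apply: (rder_mvt t0 tr) => s /andP[ts sr]; first by apply: dF; lra.
  apply: bF; first by lra.
  by rewrite rtE ger0_norm; lra.
have d0 : 0 < e / (1 + K) by rewrite divr_gt0 // ltr_pwDl.
near=> r.
have r0 : 0 <= r by near: r; exact: half_line_ge0.
have rd : `|r - t| < e / (1 + K) by near: r; exact: half_line_near.
apply: le_trans (main r r0) _; rewrite ler_wpM2r //.
rewrite mulrC; apply: le_trans (div1D_le (ltW e0) K0).
by rewrite ler_wpM2r // ltW.
Unshelve. all: by end_near. Qed.

(** [h1] and [h2] are h' and h''. The potential energies are differentiated as scalars because A h
    need not be differentiable in H; their derivatives come from the norm of H1. *)
Definition classical_solution (h h1 h2 : R -> H) : Prop :=
  forall t, 0 <= t ->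
  [/\ dom A (h t), dom A (h1 t), h2 t = - A (h t) - B (h1 t) &
   [/\ hder h t (h1 t), hder h1 t (h2 t), hder h2 t (- A (h1 t) - B (h2 t)),
    rder (fun s => ip (A (h s)) (h s)) t (2 * ip (A (h t)) (h1 t)) &
    rder (fun s => ip (A (h1 s)) (h1 s)) t (2 * ip (A (h1 t)) (h2 t))]].

(** With G the generator and z0 = (a, b), one has G z0 = (b, e) and the data of u are z0 - 2 G z0 +
    G^2 z0. Since U commutes with G, the orbit of z0 has two derivatives. *)
Lemma classical_solution_ex (a b e : H) (u : R -> H) :
  dom A a -> dom A b -> dom S e -> e = - A a - B b ->
  is_solution S j U (a - 2%:C *: b + e) (b - 2%:C *: e + (- A b - B e)) u ->
  exists h h1 h2, [/\ h 0 = a, h1 0 = b, h2 0 = e, classical_solution h h1 h2 &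
    forall t, 0 <= t -> u t = h t - 2%:C *: h1 t + h2 t].
Proof.
move=> Aa Ab Se eE hu; have [lA _ _] := A_sa; have lS := sqrt_linear.
have [_ U0 _ _ _] := hU.
pose z0 := (j a, b); pose z1 := (j b, e); pose z2 := (j e, - A b - B e).
have g01 : graph (z0, z1).
  split; first exact: dom_sqrt.
  by exists (A a); split; [exact: extension_eq_dom|rewrite /z1 eE].
have g12 : graph (z1, z2).
  by split => //; exists (A b); split; first exact: extension_eq_dom.
have c01 := (U_gen z0 z1).1 g01; have c12 := (U_gen z1 z2).1 g12.
pose h1 t := (U t z0).2; pose h2 t := (U t z1).2.
(* The first component of [U t z0] is known only in the completion H1. Since [u t] is a
   representative in H for the data of u, solving the intended relation for h gives one for z0. *)
pose h t := u t + 2%:C *: h1 t - h2 t.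
have G1 t : 0 <= t -> [/\ dom A (h1 t), dom S (h2 t), (U t z1).1 = j (h1 t) &
    U t z2 = (j (h2 t), - A (h1 t) - B (h2 t))].
  move=> t0.
  have [/= S1 [f0 [x0 /(congr1 fst)/= e1]]] := (U_gen _ _).2 (semigroup_generator hU t0 c01).
  have [/= S2 [f1 [x1 ->]]] := (U_gen _ _).2 (semigroup_generator hU t0 c12).
  have [A1 <-] : dom A (h1 t) /\ A (h1 t) = f1.
    by apply: extension_eq_inv => //; rewrite -e1.
  by split.
have G0 t : 0 <= t -> [/\ dom A (h t), (U t z0).1 = j (h t) & h2 t = - A (h t) - B (h1 t)].
  move=> t0; have [A1 S2 e1 e2] := G1 t t0.
  have [/= S1 [f0 [x0 /(congr1 snd)/= e3]]] := (U_gen _ _).2 (semigroup_generator hU t0 c01).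
  have [Su ju] := hu t t0.
  have [Su1 _] := operator_lin 2 lS Su S1.
  have [Sh _] := operatorB lS Su1 S2.
  have jh : (U t z0).1 = j (h t).
    have zE : (j (a - 2%:C *: b + e), b - 2%:C *: e + (- A b - B e)) = z0 - 2%:C *: z1 + z2.
      have Sa := dom_sqrt Aa; have Sb := dom_sqrt Ab.
      have [Sab _] := operator_lin (- 2) lS Sa Sb.
      have := embed_lin 1 Sab Se; have := embed_lin (- 2) Sa Sb.
      by rewrite rmorph1 !scale1r rmorphN !scaleNr => -> ->.
    have jE : j (h t) = j (u t) + 2%:C *: j (h1 t) - j (h2 t).
      have := embed_lin (-1) Su1 S2; rewrite rmorphN1 !scaleN1r => ->.
      by rewrite embed_lin.
    rewrite jE ju zE -e1 (_ : j (h2 t) = (U t z2).1) ?e2 //.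
    have UD x y : U t (x + y) = U t x + U t y.
      by have := semigroupB hU x (- y) t0; rewrite opprK -[in X in _ - X]scaleN1r semigroupZ // scaleN1r opprK.
    rewrite UD semigroupB // semigroupZ //= e2 /=.
    by rewrite addrAC addrK subrK.
  have [Ah Eh] : dom A (h t) /\ A (h t) = f0.
    by apply: extension_eq_inv => //; rewrite -jh.
  by split => //; rewrite Eh.
exists h, h1, h2.
have h10 : h1 0 = b by rewrite /h1 U0.
have h20 : h2 0 = e by rewrite /h2 U0.
(* Injectivity of j on D(A), by strict positivity; it identifies h(0) with a. *)
have pA u' : dom A u' -> nr (j u') = 0 -> u' = 0.
  move=> Au' ju'; apply: (positive_inj A_pos) => //.
  rewrite -embed_ip_dom //; last exact: dom_sqrt.
  by rewrite (ipxx hH1) ju' expr0n.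
have h0 : h 0 = a.
  have [A0 e0 _] := G0 0 (lexx 0); have [Ad _] := operatorB lA A0 Aa.
  apply/eqP; rewrite -subr_eq0; apply/eqP/pA => //.
  have := embed_lin (-1) (dom_sqrt A0) (dom_sqrt Aa); rewrite rmorphN1 !scaleN1r => ->.
  by rewrite -e0 U0 subrr nr0.
have d0 t : 0 <= t -> hder (U^~ z0) t (U t z1) by move=> t0; exact: semigroup_hder.
have d1 t : 0 <= t -> hder (U^~ z1) t (U t z2) by move=> t0; exact: semigroup_hder.
have dh1 t : 0 <= t -> hder h1 t (h2 t) by move=> t0; exact: hder_snd (d0 t t0).
have dh2 t : 0 <= t -> hder h2 t (- A (h1 t) - B (h2 t)).
  by move=> t0; have [_ _ _ e2] := G1 t t0; have := hder_snd (d1 t t0); rewrite e2.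
have dX0 t : 0 <= t -> hder (fun s => (U s z0).1) t (j (h1 t)).
  by move=> t0; have [_ _ <- _] := G1 t t0; exact: hder_fst (d0 t t0).
have dX1 t : 0 <= t -> hder (fun s => (U s z1).1) t (j (h2 t)).
  by move=> t0; have [_ _ _ e2] := G1 t t0; have := hder_fst (d1 t t0); rewrite e2.
(* It bounds h' through the orbit of z0, and the Lipschitz constant of h' through that of z1. *)
pose K := 2 * nr z0 + 2 * nr z1.
have dh t : 0 <= t -> hder h t (h1 t).
  apply: (@hder_weak h h1 K).
  - move=> s s0; have := nr_snd (U s z0); have := semigroup_nr hU z0 s0.
    have := nr_ge0 z1; rewrite /K /h1; lra.
  - have lip r s : 0 <= r -> r <= s -> nr (h1 s - h1 r) <= K * (s - r).
      move=> r0 rs; apply: (hder_lipschitz r0 rs (f' := h2)) => x /andP[rx _].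
        by apply: dh1; exact: le_trans rx.
      have x0 := le_trans r0 rx.
      have := nr_snd (U x z1); have := semigroup_nr hU z1 x0.
      have := nr_ge0 z0; rewrite /K /h2; lra.
    move=> r s r0 s0; have [rs|/ltW sr] := leP r s.
      by rewrite nrBC distrC ger0_norm ?subr_ge0 // lip.
    by rewrite ger0_norm ?subr_ge0 // lip.
  - move=> s v s0 Av; have [A1 _ _ _] := G1 s s0; have jv := dom_sqrt Av.
    have := rder_ip hH1 (dX0 s s0) (hder_cst (j v) s).
    rewrite ip0r addr0 embed_ip_dom // (self_adjoint_sym A_sa A1 Av).
    apply: rder_ext => // r r0; have [Ar -> _] := G0 r r0.
    by rewrite embed_ip_dom // (self_adjoint_sym A_sa Ar Av).
split => //.
  move=> t t0; have [At _ Et] := G0 t t0; have [A1t S2t _ _] := G1 t t0.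
  split => //; split => //; [exact: dh|exact: dh1|exact: dh2| |].
  - have := rder_ip hH1 (dX0 t t0) (dX0 t t0).
    have [_ -> _] := G0 t t0; rewrite (ipC dot1 (j (h1 t))) embed_ip_dom //; last exact: dom_sqrt.
    rewrite -mulr2n -[X in rder _ _ X]mulr_natl.
    apply: rder_ext => // r r0; have [Ar -> _] := G0 r r0.
    by rewrite embed_ip_dom //; exact: dom_sqrt.
  - have := rder_ip hH1 (dX1 t t0) (dX1 t t0).
    have [_ _ -> _] := G1 t t0; rewrite (ipC dot1 (j (h2 t))) embed_ip_dom //.
    rewrite -mulr2n -[X in rder _ _ X]mulr_natl.
    apply: rder_ext => // r r0; have [Ar _ -> _] := G1 r r0.
    by rewrite embed_ip_dom //; exact: dom_sqrt.
by move=> t t0; rewrite /h; apply: (ip_ext hH) => w; rewrite !ipE; ring.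
Qed.

End ClassicalSolutions.

(** * Weighted energy decay *)

Section Lyapunov.
Variables (R : realType) (H : completeNormedModType R[i]).
Variable dot : {dot H for Num.conj}.
Hypothesis hH : hilbert_norm dot.
Local Notation ip := (re_dot dot).
Variables (A : operator H) (B : H -> H) (c K : R).
Hypotheses (c_gt0 : 0 < c) (K_ge0 : 0 <= K) (B_lin : linear B).
Hypotheses (B_bound : forall u, nr (B u) <= K * nr u)
  (B_sym : forall u v, ip (B u) v = ip u (B v))
  (B_low : forall u, c * nr u ^+ 2 <= ip (B u) u)
  (A_ge0 : forall u, dom A u -> 0 <= ip (A u) u).

(** [l] makes the dissipation 2 l (B g, g) at least 4 |g|^2. With G the damped energy of h' and E
    its energy, the others cancel bad terms: [ga] the part 4 (1 + l) t E of 4 t G, [be] the part of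
    ga G in E, and the two summands of [al] the parts of 4 t G and of ga G in |h'|^2. *)
Let l := 2 / c.
Let be := (1 + l) ^+ 2.
Let ga := 2 * (1 + l).
Let al := 2 * (K + 1) / c + 2 * (1 + l) * (K + 1).

Let l_gt0 : 0 < l. Proof. by rewrite /l divr_gt0. Qed.
Let al_gt0 : 0 < al.
Proof.
have K1 : 0 < K + 1 by rewrite ltr_wpDl.
by rewrite /al addr_gt0 ?divr_gt0 ?mulr_gt0 // addr_gt0.
Qed.
Let lc : l * c = 2. Proof. by rewrite /l divfK // gt_eqF. Qed.

Lemma B_up u : ip (B u) u <= K * nr u ^+ 2.
Proof.
rewrite (le_trans (ip_le hH _ _)) // expr2 mulrA.
by rewrite ler_wpM2r ?nr_ge0.
Qed.

Definition energy (f g : R -> H) t := nr (g t) ^+ 2 + ip (A (f t)) (f t).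
(** The first two terms have derivative 2 |g|^2 - 2 (A f, f), in which B has cancelled: this
    produces decay of the potential energy, which the energy identity alone does not show. The
    multiple [l] of the energy absorbs 2 |g|^2. *)
Definition damped_energy (f g : R -> H) t :=
  ip (B (f t)) (f t) + 2 * ip (g t) (f t) + l * energy f g t.

Lemma energy_rder (f g : R -> H) t : dom A (f t) -> hder f t (g t) ->
  hder g t (- A (f t) - B (g t)) ->
  rder (fun s => ip (A (f s)) (f s)) t (2 * ip (A (f t)) (g t)) ->
  rder (energy f g) t (- 2 * ip (B (g t)) (g t)).
Proof.
move=> Af hf hg hA.
have := rderD (rder_ip hH hg hg) hA.
rewrite (_ : _ + _ = - 2 * ip (B (g t)) (g t)).
  by congr (rder _ t _); apply/funext => s; rewrite /energy (ipxx hH).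
by rewrite !ipE (ipC dot (g t) (A _)) (ipC dot (g t) (B _)); ring.
Qed.

Lemma damped_energy_rder (f g : R -> H) t : dom A (f t) -> hder f t (g t) ->
  hder g t (- A (f t) - B (g t)) ->
  rder (fun s => ip (A (f s)) (f s)) t (2 * ip (A (f t)) (g t)) ->
  rder (damped_energy f g) t
    (2 * nr (g t) ^+ 2 - 2 * ip (A (f t)) (f t) + l * (- 2 * ip (B (g t)) (g t))).
Proof.
move=> Af hf hg hA.
have hBf := hder_lin B_lin B_bound hf.
have := rderD (rderD (rder_ip hH hBf hf) (rder_scale 2 (rder_ip hH hg hf)))
  (rder_scale l (energy_rder Af hf hg hA)).
congr (rder _ t _); rewrite -(ipxx hH) !ipE (B_sym (g t) (f t)) (ipC dot (g t) (B (f t))) /=.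
by ring.
Qed.

(** Completing the square: 2 (g, f) costs (c/2) |f|^2 and (2/c) |g|^2, and the latter is exactly l
    |g|^2. *)
Lemma damped_energy_ge (f g : R -> H) t : dom A (f t) ->
  c / 2 * nr (f t) ^+ 2 <= damped_energy f g t.
Proof.
move=> Af; rewrite /damped_energy /energy.
have := B_low (f t); have := A_ge0 Af.
have := sqr_ge0 (nr ((c / 2)%:C *: f t + g t)).
rewrite -!(ipxx hH) !ipE (ipC dot (f t) (g t)); have := lc; have := l_gt0.
move: (ip (f t) (f t)) (ip (g t) (f t)) (ip (g t) (g t)) (ip (A _) _) (ip (B _) _).
move=> x r y p b lp lcE sq p0 bx.
have : 0 <= l * (c / 2 * (c / 2 * x + r) + (c / 2 * r + y)).
  by rewrite mulr_ge0 ?(ltW lp) //; move: sq; lra.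
have -> : l * (c / 2 * (c / 2 * x + r) + (c / 2 * r + y)) =
  (l * c) * (c * x / 4 + r) + l * y by field.
have : 0 <= l * p by rewrite mulr_ge0 ?(ltW lp).
by rewrite lcE; lra.
Qed.

Lemma damped_energy_le (f g : R -> H) t : dom A (f t) ->
  damped_energy f g t <= (K + 1) * nr (f t) ^+ 2 + (1 + l) * energy f g t.
Proof.
move=> Af; rewrite /damped_energy /energy.
have := B_up (f t); have := A_ge0 Af.
have := sqr_ge0 (nr (f t - g t)).
rewrite -!(ipxx hH) !ipE (ipC dot (f t) (g t)).
by lra.
Qed.

Lemma energy_ge0 (f g : R -> H) t : dom A (f t) -> 0 <= energy f g t.
Proof. by move=> Af; rewrite addr_ge0 ?sqr_ge0 ?A_ge0. Qed.

(** The dissipation of a damped energy is a full energy, which pays for one more factor t. The step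
    from h to h' works because the weighted dissipation t (B h', h') controls t |h'|^2, the part of
    the damped energy of h' that its own dissipation misses. *)
Definition lyapunov (h h1 h2 : R -> H) t :=
  al * (damped_energy h h1 t + t * energy h h1 t) + be * damped_energy h1 h2 t
  + ga * (t * damped_energy h1 h2 t) + 2 * (t * (t * damped_energy h1 h2 t))
  + t * (t * (t * energy h1 h2 t)).

(* The weights make every term with a positive sign in the derivative of one *)
(* summand absorbed by the derivative of a summand of higher or equal weight. *)
Lemma lyapunov_algebra (t y z p q B1 B2 G D0 D1 : R) : 0 <= t -> 0 <= y -> 0 <= z ->
  0 <= p -> 0 <= q -> c * y <= B1 -> c * z <= B2 ->
  G <= (K + 1) * y + (1 + l) * (z + q) ->
  D0 = 2 * y - 2 * p + l * (- 2 * B1) ->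
  D1 = 2 * z - 2 * q + l * (- 2 * B2) ->
  al * (D0 + (y + p) - 2 * (t * B1)) + be * D1 + ga * (G + t * D1)
  + 2 * (2 * (t * G) + t * (t * D1)) + 3 * (t * (t * (z + q))) - 2 * (t ^+ 3 * B2)
  <= - (2 * c) * t ^+ 3 * z.
Proof.
move=> t0 y0 z0 p0 q0 b1 b2 hG D0E D1E.
have lp := ltW l_gt0; have c0 := ltW c_gt0.
have hD0 : D0 <= - (2 * (y + p)).
  have : l * (c * y) <= l * B1 by rewrite ler_wpM2l.
  by rewrite mulrA lc D0E; lra.
have hD1 : D1 <= - (2 * (z + q)).
  have : l * (c * z) <= l * B2 by rewrite ler_wpM2l.
  by rewrite mulrA lc D1E; lra.
set E := z + q in hG hD1 *; have E0 : 0 <= E by rewrite addr_ge0.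
have ga0 : 0 <= ga by rewrite mulr_ge0 // addr_ge0.
have be0 : 0 <= be by rewrite sqr_ge0.
have tb : t * (c * y) <= t * B1 by rewrite ler_wpM2l.
have T1 : al * (D0 + (y + p) - 2 * (t * B1)) <= al * (- y - 2 * (t * (c * y))).
  by rewrite ler_wpM2l ?(ltW al_gt0) //; lra.
have T2 : be * D1 <= be * (- (2 * E)) by rewrite ler_wpM2l.
have tD : t * D1 <= t * (- (2 * E)) by rewrite ler_wpM2l.
have tG : t * G <= t * ((K + 1) * y + (1 + l) * E) by rewrite ler_wpM2l.
have ttD : t * (t * D1) <= t * (t * (- (2 * E))) by rewrite ler_wpM2l.
have T3 : ga * (G + t * D1) <= ga * ((K + 1) * y + (1 + l) * E + t * (- (2 * E))).
  by rewrite ler_wpM2l // lerD.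
have T5 : t ^+ 3 * (c * z) <= t ^+ 3 * B2 by rewrite ler_wpM2l // exprn_ge0.
have K1 : 0 <= K + 1 by rewrite addr_ge0.
have R1 : 0 <= 2 * (K + 1) / c * y by rewrite !mulr_ge0 ?invr_ge0.
have R2 : 0 <= t * c * (1 + l) * (K + 1) * y by rewrite !mulr_ge0 // addr_ge0.
have R3 : 0 <= t * (t * E) by rewrite !mulr_ge0.
have alE : al * (- y - 2 * (t * (c * y))) =
   - (2 * (K + 1) / c * y) - 2 * (1 + l) * (K + 1) * y - 4 * ((K + 1) * (t * y))
   - 4 * (t * c * (1 + l) * (K + 1) * y).
  by rewrite /al; field; rewrite gt_eqF.
rewrite alE in T1; move: T1 T2 T3; rewrite /be /ga.
move: (2 * (K + 1) / c * y) R1 => r1 R1 T1 T2 T3.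
by lra.
Qed.

Lemma lyapunov_rder (h h1 h2 : R -> H) t : 0 <= t -> classical_solution dot A B h h1 h2 ->
  exists2 d, rder (lyapunov h h1 h2) t d & d <= - (2 * c) * t ^+ 3 * nr (h2 t) ^+ 2.
Proof.
move=> t0 hs; have [Ah Ah1 e2 [d0 d1 d2 dA0 dA1]] := hs t t0.
have d1' := d1; rewrite e2 in d1'.
have dE0 := energy_rder Ah d0 d1' dA0; have dG0 := damped_energy_rder Ah d0 d1' dA0.
have dE1 := energy_rder Ah1 d1 d2 dA1; have dG1 := damped_energy_rder Ah1 d1 d2 dA1.
have ri := rder_id t.
have dtG1 := rderM ri dG1; have dttG1 := rderM ri dtG1.
have dE3 := rderM ri (rderM ri (rderM ri dE1)).
eexists.
  apply: rderD (rderD (rderD (rderD (rder_scale al (rderD dG0 (rderM ri dE0)))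
    (rder_scale be dG1)) (rder_scale ga dtG1)) (rder_scale 2 dttG1)) dE3.
have g1le := damped_energy_le h2 Ah1.
have b1 := B_low (h1 t); have b2 := B_low (h2 t).
have q0 := A_ge0 Ah1; have p0 := A_ge0 Ah.
have y0 := sqr_ge0 (nr (h1 t)); have z0 := sqr_ge0 (nr (h2 t)).
move: g1le; rewrite /energy.
move: (damped_energy h1 h2 t) (nr (h1 t) ^+ 2) (nr (h2 t) ^+ 2) b1 b2 q0 p0 y0 z0.
move: (ip (B (h1 t)) (h1 t)) (ip (B (h2 t)) (h2 t)) (ip (A (h t)) (h t)) (ip (A (h1 t)) (h1 t)).
move=> B1 B2 p q G y z b1 b2 q0 p0 y0 z0 g1le.
have := lyapunov_algebra t0 y0 z0 p0 q0 b1 b2 g1le erefl erefl; apply: le_trans.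
by rewrite le_eqVlt; apply/orP; left; apply/eqP; ring.
Qed.

Lemma lyapunov_ge (h h1 h2 : R -> H) t : 0 <= t -> dom A (h t) -> dom A (h1 t) ->
  al * (c / 2) * nr (h t) ^+ 2 + c * (t * nr (h1 t)) ^+ 2 + t ^+ 3 * nr (h2 t) ^+ 2
  <= lyapunov h h1 h2 t.
Proof.
move=> t0 Ah Ah1; rewrite /lyapunov.
have c0 := ltW c_gt0; have lp := ltW l_gt0; have al0 := ltW al_gt0.
have G0 := damped_energy_ge h1 Ah; have G1 := damped_energy_ge h2 Ah1.
have E0 := energy_ge0 h1 Ah.
have E1 : nr (h2 t) ^+ 2 <= energy h1 h2 t by rewrite /energy lerDl A_ge0.
have G1p : 0 <= damped_energy h1 h2 t.
  by apply: le_trans G1; rewrite mulr_ge0 ?sqr_ge0 // divr_ge0.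
have ga0 : 0 <= ga by rewrite mulr_ge0 // addr_ge0.
have be0 : 0 <= be by rewrite sqr_ge0.
have T1 : al * (c / 2 * nr (h t) ^+ 2) <= al * (damped_energy h h1 t + t * energy h h1 t).
  by rewrite ler_wpM2l // -[leLHS]addr0 lerD // mulr_ge0.
have T2 : 0 <= be * damped_energy h1 h2 t by rewrite mulr_ge0.
have T3 : 0 <= ga * (t * damped_energy h1 h2 t) by rewrite mulr_ge0 // mulr_ge0.
have T4 : t * (t * (c / 2 * nr (h1 t) ^+ 2)) <= t * (t * damped_energy h1 h2 t).
  by rewrite !ler_wpM2l.
have T5 : t * (t * (t * nr (h2 t) ^+ 2)) <= t * (t * (t * energy h1 h2 t)).
  by rewrite !ler_wpM2l.
by lra.
Qed.

Lemma lyapunov_le0 (h h1 h2 : R -> H) (M : R) : dom A (h 0) -> dom A (h1 0) ->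
  nr (h 0) <= M -> nr (h1 0) <= M -> nr (h2 0) <= M ->
  ip (A (h 0)) (h 0) <= M ^+ 2 -> ip (A (h1 0)) (h1 0) <= M ^+ 2 ->
  lyapunov h h1 h2 0 <= (al + be) * (K + 1 + 2 * (1 + l)) * M ^+ 2.
Proof.
move=> Ah Ah1 m0 m1 m2 p q; rewrite /lyapunov !mul0r !(mulr0, addr0).
have lp := ltW l_gt0; have K1 : 0 <= K + 1 by rewrite addr_ge0.
have sq x : 0 <= x -> x <= M -> x ^+ 2 <= M ^+ 2.
  by move=> x0 xM; rewrite ler_sqr ?nnegrE // (le_trans x0).
have bd f g : dom A (f 0) -> nr (f 0) <= M -> nr (g 0) <= M -> ip (A (f 0)) (f 0) <= M ^+ 2 ->
    damped_energy f g 0 <= (K + 1 + 2 * (1 + l)) * M ^+ 2.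
  move=> Af f0 g0 pf; apply: le_trans (damped_energy_le g Af) _.
  have := ler_wpM2l K1 (sq _ (nr_ge0 _) f0).
  have e : energy f g 0 <= 2 * M ^+ 2 by have := sq _ (nr_ge0 _) g0; rewrite /energy; lra.
  have := ler_wpM2l (_ : 0 <= 1 + l) e; rewrite addr_ge0 // => /(_ isT); lra.
have := ler_wpM2l (ltW al_gt0) (bd h h1 Ah m0 m1 p).
have := ler_wpM2l (sqr_ge0 (1 + l)) (bd h1 h2 Ah1 m1 m2 q).
by rewrite -/be; lra.
Qed.

(** The Lyapunov function is returned with its derivative, so that it can stand for the integral of
    s^3 |h''(s)|^2 in the pairing estimate. *)
Lemma classical_decay : exists2 C : R, 0 < C &
  forall (h h1 h2 : R -> H) (M : R), classical_solution dot A B h h1 h2 ->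
  0 <= M -> nr (h 0) <= M -> nr (h1 0) <= M -> nr (h2 0) <= M ->
  ip (A (h 0)) (h 0) <= M ^+ 2 -> ip (A (h1 0)) (h1 0) <= M ^+ 2 ->
  exists L L' : R -> R, forall t, 0 <= t ->
  [/\ rder L t (L' t), L' t <= - (2 * c) * t ^+ 3 * nr (h2 t) ^+ 2,
     0 <= L t <= C * M ^+ 2 &
     [/\ nr (h t) <= C * M, t * nr (h1 t) <= C * M & t ^+ 3 * nr (h2 t) ^+ 2 <= C * M ^+ 2]].
Proof.
pose C0 := (al + be) * (K + 1 + 2 * (1 + l)).
have C00 : 0 <= C0.
  have lp := ltW l_gt0; have al0 := ltW al_gt0.
  have K0 := K_ge0; apply: mulr_ge0; last by lra.
  by apply: addr_ge0 => //; exact: sqr_ge0.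
pose c1 := al * (c / 2); have c10 : 0 < c1 by rewrite mulr_gt0 ?al_gt0 // divr_gt0.
exists (1 + C0 + C0 / c1 + C0 / c) => [|h h1 h2 M hs M0 m0 m1 m2 p q].
  by rewrite -!addrA ltr_pwDl // !addr_ge0 // divr_ge0 // ltW.
set C := 1 + _ + _ + _.
have Q1 : 0 <= C0 / c1 by rewrite divr_ge0 // ltW.
have Q2 : 0 <= C0 / c by rewrite divr_ge0 // ltW.
have C1 : 1 <= C by rewrite /C; lra.
(* The Lyapunov bound controls squares by C M^2; since C >= 1, this yields linear bounds by C M. *)
have CC : C <= C ^+ 2 by rewrite expr2 ler_peMr // (le_trans _ C1).
have M2 := sqr_ge0 M.
have [L' hL'] : exists L' : R -> R, forall t, 0 <= t -> rder (lyapunov h h1 h2) t (L' t) /\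
    L' t <= - (2 * c) * t ^+ 3 * nr (h2 t) ^+ 2.
  have /choice[L' hL'] : forall t, exists d, 0 <= t -> rder (lyapunov h h1 h2) t d /\
      d <= - (2 * c) * t ^+ 3 * nr (h2 t) ^+ 2.
    move=> t; have [t0|t0] := leP 0 t; last by exists 0.
    by have [d d1 d2] := lyapunov_rder t0 hs; exists d.
  by exists L'.
exists (lyapunov h h1 h2), L' => t t0; have [d1 d2] := hL' t t0.
have [Ah Ah1 _ _] := hs t t0; have [Ah0 Ah10 _ _] := hs 0 (lexx 0).
have Lt0 : lyapunov h h1 h2 t <= lyapunov h h1 h2 0.
  apply: (rder_le0_nincr (lexx 0) t0 (F' := L')) => s /andP[s0 _]; have [e1 e2] := hL' s s0 => //.
  apply: le_trans e2 _; rewrite !mulNr oppr_le0 !mulr_ge0 ?exprn_ge0 ?nr_ge0 //.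
  exact: ltW.
have LC : lyapunov h h1 h2 t <= C0 * M ^+ 2.
  by apply: le_trans Lt0 (lyapunov_le0 Ah0 Ah10 m0 m1 m2 p q).
have := lyapunov_ge h2 t0 Ah Ah1; rewrite -/c1 => lowL.
have X1 : 0 <= c1 * nr (h t) ^+ 2 by rewrite mulr_ge0 ?sqr_ge0 // ltW.
have X2 : 0 <= c * (t * nr (h1 t)) ^+ 2 by rewrite mulr_ge0 ?sqr_ge0 // ltW.
have X3 : 0 <= t ^+ 3 * nr (h2 t) ^+ 2 by rewrite mulr_ge0 ?sqr_ge0 // exprn_ge0.
have sqle x k : 0 <= x -> 0 < k -> C0 / k <= C -> k * x ^+ 2 <= C0 * M ^+ 2 -> x <= C * M.
  move=> x0 k0 kC kx; have Cp : 0 <= C by apply: le_trans C1.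
  rewrite -ler_sqr ?nnegrE ?mulr_ge0 //.
  rewrite exprMn; apply: (@le_trans _ _ (C * M ^+ 2)); last by rewrite ler_wpM2r.
  apply: (@le_trans _ _ (C0 / k * M ^+ 2)); last by rewrite ler_wpM2r.
  by rewrite mulrAC ler_pdivlMr // mulrC.
have CM : C0 * M ^+ 2 <= C * M ^+ 2 by rewrite ler_wpM2r // /C; lra.
split => //; first by apply/andP; split; lra.
split; last by lra.
- by apply: (sqle _ c1) => //; [exact: nr_ge0|rewrite /C; lra|lra].
- by apply: (sqle _ c) => //; [rewrite mulr_ge0 ?nr_ge0|rewrite /C; lra|lra].
Qed.

End Lyapunov.

(** * Duality with the heat flow *)

Section SlabSums.
Variables (R : realType) (H : completeNormedModType R[i]).
Variable dot : {dot H for Num.conj}.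
Hypothesis hH : hilbert_norm dot.
Local Notation ip := (re_dot dot).
Variable P : nat -> H -> H.
Hypothesis P_orth : forall j k u v,
  ip (P j u) (P k v) = if j == k then ip (P j u) v else 0.

Lemma nr_slab_sum (f : nat -> H) n : (forall k, P k (f k) = f k) ->
  nr (\sum_(0 <= k < n) f k) ^+ 2 = \sum_(0 <= k < n) nr (f k) ^+ 2.
Proof.
move=> Pf; elim: n => [|n IHn]; first by rewrite !big_geq // nr0 expr0n.
rewrite !big_nat_recr //= -IHn -!(ipxx hH) !ipE.
have h0 : ip (\sum_(0 <= i < n) f i) (f n) = 0.
  rewrite ip_suml big_nat big1 // => i /andP[_ i_n].
  by rewrite -(Pf i) -(Pf n) P_orth ltn_eqF.
by rewrite (ipC dot (f n)) h0 addr0 add0r.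
Qed.

(** Slabs are orthogonal, so slabwise bounds add up with a constant independent of n. *)
Lemma nr_slab_sum_le (f g : nat -> H) n (W : R) : 0 <= W ->
  (forall k, P k (f k) = f k) -> (forall k, P k (g k) = g k) ->
  (forall k, nr (f k) <= W * nr (g k)) ->
  nr (\sum_(0 <= k < n) f k) <= W * nr (\sum_(0 <= k < n) g k).
Proof.
move=> W0 Pf Pg fg; rewrite -ler_sqr ?nnegrE ?mulr_ge0 ?nr_ge0 // exprMn.
rewrite !nr_slab_sum // mulr_sumr ler_sum // => k _.
by rewrite -exprMn ler_sqr ?nnegrE ?mulr_ge0 ?nr_ge0.
Qed.

End SlabSums.

Section ExponentialWeights.
Variable R : realType.

Lemma expRN_bound1 (r x : R) : 0 <= x -> 0 < r -> x * expR (- (r * x)) <= r^-1.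
Proof.
move=> x0 r0; rewrite -(ler_pM2l r0) divff ?gt_eqF // mulrA.
rewrite -(ler_pM2r (expR_gt0 (r * x))) -mulrA -expRD addNr expR0 mulr1 mul1r.
by apply: le_trans (expR_ge1Dx _); lra.
Qed.

(** The square of the first-order bound at rate r / 2, whence the 4. *)
Lemma expRN_bound2 (r x : R) : 0 <= x -> 0 < r -> x * (x * expR (- (r * x))) <= 4 * (r^-1 * r^-1).
Proof.
move=> x0 r0; have r2 : 0 < r / 2 by rewrite divr_gt0.
have := expRN_bound1 x0 r2; set b := x * _ => hb.
have b0 : 0 <= b by rewrite mulr_ge0 // expR_ge0.
have -> : x * (x * expR (- (r * x))) = b * b.
  by rewrite /b mulrACA -expRD -mulrA; congr (_ * (_ * expR _)); field.
have -> : 4 * (r^-1 * r^-1) = (r / 2)^-1 * (r / 2)^-1 by field; rewrite gt_eqF.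
exact: ler_pM.
Qed.

Lemma expRN_rder (t x s : R) : rder (fun s => expR (- ((t - s) * x))) s (x * expR (- ((t - s) * x))).
Proof.
apply: is_derive_rder.
have df : is_derive s (1 : R) (x \*: (@id R) + cst (- (t * x))) (x *: 1 + 0).
  by apply: is_deriveD; apply: is_deriveZ.
have := is_derive1_comp (is_derive_expR _) df.
rewrite addr0 [x *: 1]mulr1 [in X in is_derive _ _ _ X]mulrC.
have fE r : (x \*: (@id R) + cst (- (t * x))) r = - ((t - r) * x).
  by rewrite /= !fctE /= /GRing.scale /=; ring.
rewrite fE; congr (is_derive _ _ _ _); apply/funext => r /=; by rewrite fE.
Qed.

End ExponentialWeights.

(** * Pairing the wave with the backward heat flow *)

Section HeatDuality.
Variables (R : realType) (H : completeNormedModType R[i]).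
Variable dot : {dot H for Num.conj}.
Hypothesis hH : hilbert_norm dot.
Local Notation ip := (re_dot dot).
Variables (A : operator H) (B Bh Bmh heat : H -> H) (k c : R).
Hypotheses (A_lin : linear_operator A)
  (A_sym : forall u v, dom A u -> dom A v -> ip (A u) v = ip u (A v)).
Hypotheses (B_lin : linear B) (Bh_lin : linear Bh) (Bmh_lin : linear Bmh)
  (heat_lin : linear heat).
Hypotheses (k_ge0 : 0 <= k) (c_gt0 : 0 < c) (B_bound : forall u, nr (B u) <= k * nr u)
  (Bh_bound : forall u, nr (Bh u) <= k * nr u)
  (Bmh_bound : forall u, nr (Bmh u) <= k * nr u).
Hypotheses (BhBh : forall u, Bh (Bh u) = B u) (BhK : cancel Bh Bmh) (BmhK : cancel Bmh Bh).
Hypotheses (B_sym : forall u v, ip (B u) v = ip u (B v))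
  (Bh_sym : forall u v, ip (Bh u) v = ip u (Bh v))
  (Bmh_dom : forall u, dom A u -> dom A (Bmh u)).
Let At := sandwich Bmh A.
Variables (P : nat -> H -> H) (t e : R).
Hypotheses (t_gt1 : 1 < t) (eE : e = t^-1 * t^-1).
Hypotheses (P_dom : forall j u, dom A (P j u)) (P_idem : forall j u, P j (P j u) = P j u)
  (P_At : forall j u, P j (At (P j u)) = At (P j u))
  (P_heat : forall j u, P j (heat (P j u)) = heat (P j u))
  (P_lin : forall j (a : R) u v, P j (u + a%:C *: v) = P j u + a%:C *: P j v)
  (P_orth : forall i j u v, ip (P i u) (P j v) = if i == j then ip (P i u) v else 0)
  (At_slab : forall j u, nr (At (P j u) - (j%:R * e)%:C *: P j u) <= e * nr (P j u))
  (heat_slab : forall j u,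
     nr (heat (P j u) - (expR (- t * (j%:R * e)))%:C *: P j u) <= t * e * nr (P j u)).
Variables (v : H) (n : nat).

Let t_gt0 : 0 < t. Proof. exact: lt_trans t_gt1. Qed.
Let tV_gt0 : 0 < t^-1. Proof. by rewrite invr_gt0. Qed.
Let e_gt0 : 0 < e. Proof. by rewrite eE mulr_gt0. Qed.

Lemma lin0 (T : H -> H) : linear T -> T 0 = 0.
Proof. by move=> lT; have := lT (-1) 0 0; rewrite !scaleN1r !addNr. Qed.

Lemma linZ (T : H -> H) (a : R[i]) u : linear T -> T (a *: u) = a *: T u.
Proof. by move=> lT; have := lT a u 0; rewrite (lin0 lT) !addr0. Qed.

Lemma linD (T : H -> H) u w : linear T -> T (u + w) = T u + T w.
Proof. by move=> lT; have := lT 1 u w; rewrite !scale1r. Qed.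

Lemma linB (T : H -> H) u w : linear T -> T (u - w) = T u - T w.
Proof. by move=> lT; rewrite -scaleN1r (linD _ _ lT) (linZ _ _ lT) scaleN1r. Qed.

Definition rate (j : nat) : R := j%:R * e.
(** For w j = f (rate j) this stands for f(A~) applied to the first n slabs of v. *)
Definition slab_sum (w : nat -> R) : H := \sum_(0 <= j < n) (w j)%:C *: P j v.
Let phi := slab_sum (fun=> 1).

Lemma rate_ge0 j : 0 <= rate j. Proof. by rewrite mulr_ge0 // ltW. Qed.

Lemma slabZ j (a : R) u : P j u = u -> P j (a%:C *: u) = a%:C *: u.
Proof.
move=> Pu; have P0 : P j 0 = 0.
  by have := P_lin j (-1) 0 0; rewrite rmorphN1 !scaleN1r !subrr.
by have := P_lin j a 0 u; rewrite !add0r P0 add0r Pu.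
Qed.

Lemma slab_sum_le (f : nat -> H) (W : R) : 0 <= W -> (forall j, P j (f j) = f j) ->
  (forall j, nr (f j) <= W * nr (P j v)) ->
  nr (\sum_(0 <= j < n) f j) <= W * nr phi.
Proof.
move=> W0 Pf fW; apply: (nr_slab_sum_le hH P_orth) => // j; first exact: slabZ.
by rewrite rmorph1 scale1r.
Qed.

Lemma slab_sum_bound (w : nat -> R) (W : R) : 0 <= W -> (forall j, `|w j| <= W) ->
  nr (slab_sum w) <= W * nr phi.
Proof.
move=> W0 wW; apply: slab_sum_le => // j; first exact: slabZ.
by rewrite nrZ ler_wpM2r ?nr_ge0.
Qed.

Lemma At_slab_sum (w : nat -> R) : dom A (slab_sum w) /\
  At (slab_sum w) = \sum_(0 <= j < n) (w j)%:C *: At (P j v).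
Proof.
rewrite /slab_sum; elim: n => [|m [IHd IH]].
  rewrite !big_geq //; split; first exact: A_lin.1.
  rewrite /At /= (lin0 Bmh_lin); have [_] := operatorB A_lin A_lin.1 A_lin.1.
  by rewrite !subrr => ->; rewrite lin0.
rewrite !big_nat_recr //= -IH; set s := \sum_(0 <= i < m) _ in IHd *.
split; first by have [] := operator_lin (w m) A_lin IHd (P_dom m v).
rewrite /At /= (linD _ _ Bmh_lin) (linZ _ _ Bmh_lin).
have [_ ->] := operator_lin (w m) A_lin (Bmh_dom IHd) (Bmh_dom (P_dom m v)).
by rewrite (linD _ _ Bmh_lin) (linZ _ _ Bmh_lin).
Qed.

Lemma At_slab_sum_approx (w : nat -> R) (W : R) : 0 <= W -> (forall j, `|w j| <= W) ->
  nr (At (slab_sum w) - slab_sum (fun j => rate j * w j)) <= e * W * nr phi.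
Proof.
move=> W0 wW; rewrite (At_slab_sum w).2 /slab_sum.
have -> : \sum_(0 <= j < n) (w j)%:C *: At (P j v) - \sum_(0 <= j < n) (rate j * w j)%:C *: P j v
    = \sum_(0 <= j < n) (w j)%:C *: (At (P j v) - (rate j)%:C *: P j v).
  rewrite -sumrB; apply: eq_bigr => j _.
  by rewrite scalerBr scalerA -rmorphM mulrC.
apply: slab_sum_le => [|j|j]; first by rewrite mulr_ge0 // ltW.
  apply: slabZ; have := P_lin j (- rate j) (At (P j v)) (P j v).
  by rewrite P_At P_idem rmorphN !scaleNr.
by rewrite nrZ mulrC (mulrC e) -mulrA mulrC ler_pM ?nr_ge0 // At_slab.
Qed.

Definition weight (s : R) (j : nat) : R := expR (- ((t - s) * rate j)).

Lemma heat_slab_sum : nr (heat phi - slab_sum (weight 0)) <= t^-1 * nr phi.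
Proof.
have hE : heat phi = \sum_(0 <= j < n) heat (P j v).
  rewrite /phi /slab_sum; elim: n => [|m IH]; first by rewrite !big_geq // lin0.
  by rewrite !big_nat_recr //= (linD _ _ heat_lin) IH rmorph1 scale1r.
have -> : t^-1 = t * e by rewrite eE mulrA divff ?mul1r // gt_eqF.
rewrite hE /slab_sum -sumrB.
apply: slab_sum_le => [|j|j]; first by rewrite mulr_ge0 // ltW.
  have := P_lin j (- weight 0 j) (heat (P j v)) (P j v).
  by rewrite P_heat P_idem rmorphN !scaleNr.
by rewrite /weight subr0 -mulNr; exact: heat_slab.
Qed.

Lemma slab_sum_hder (w : R -> nat -> R) (w' : nat -> R) s :
  (forall j, rder (w^~ j) s (w' j)) -> hder (fun s => slab_sum (w s)) s (slab_sum w').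
Proof. by move=> hw; apply: hder_sum => j; apply: hder_scale; exact: hw. Qed.

Definition weight1 s j := rate j * weight s j.
Definition weight2 s j := rate j * weight1 s j.

Lemma weight_le1 s j : s <= t -> `|weight s j| <= 1.
Proof.
move=> st; rewrite ger0_norm ?expR_ge0 // -expR0 ler_expR oppr_le0.
by rewrite mulr_ge0 ?rate_ge0 // subr_ge0.
Qed.

Lemma weight1_ge0 s j : 0 <= weight1 s j.
Proof. by apply: mulr_ge0; [exact: rate_ge0|exact: expR_ge0]. Qed.

Lemma weight1_le s j : s < t -> `|weight1 s j| <= (t - s)^-1.
Proof.
move=> st; rewrite ger0_norm ?weight1_ge0 //.
by apply: expRN_bound1; rewrite ?rate_ge0 // subr_gt0.
Qed.

Lemma weight2_le s j : s < t -> `|weight2 s j| <= 4 * ((t - s)^-1 * (t - s)^-1).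
Proof.
move=> st; rewrite ger0_norm; last by apply: mulr_ge0; [exact: rate_ge0|exact: weight1_ge0].
by apply: expRN_bound2; rewrite ?rate_ge0 // subr_gt0.
Qed.

(* [dual s] nearly solves the backward equation B y' = A y with final value Bmh phi. *)
Definition dual s := Bmh (slab_sum (weight s)).
Definition dual1 s := Bmh (slab_sum (weight1 s)).
Definition dual2 s := Bmh (slab_sum (weight2 s)).

Lemma dual_hder s : hder dual s (dual1 s).
Proof.
apply: (hder_lin Bmh_lin Bmh_bound); apply: slab_sum_hder => j; exact: expRN_rder.
Qed.

Lemma dual1_hder s : hder dual1 s (dual2 s).
Proof.
apply: (hder_lin Bmh_lin Bmh_bound); apply: slab_sum_hder => j.
by apply: rder_scale; exact: expRN_rder.
Qed.

Lemma dual_le s : s <= t -> nr (dual s) <= k * nr phi.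
Proof.
move=> st; apply: le_trans (Bmh_bound _) _; rewrite ler_wpM2l // -[leRHS]mul1r.
by apply: slab_sum_bound => // j; exact: weight_le1.
Qed.

Lemma dual1_le s : s < t -> nr (dual1 s) <= k * ((t - s)^-1 * nr phi).
Proof.
move=> st; apply: le_trans (Bmh_bound _) _; rewrite ler_wpM2l //.
apply: slab_sum_bound => [|j]; last exact: weight1_le.
by rewrite invr_ge0 subr_ge0 ltW.
Qed.

Lemma dual2_le s : s < t -> nr (dual2 s) <= k * (4 * ((t - s)^-1 * (t - s)^-1) * nr phi).
Proof.
move=> st; apply: le_trans (Bmh_bound _) _; rewrite ler_wpM2l //.
apply: slab_sum_bound => [|j]; last exact: weight2_le.
by rewrite !mulr_ge0 // invr_ge0 subr_ge0 ltW.
Qed.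

Lemma dual_dom s : dom A (dual s).
Proof. by apply: Bmh_dom; exact: (At_slab_sum (weight s)).1. Qed.

(** Both B B^(-1/2) = B^(1/2) and A B^(-1/2) = B^(1/2) A~ carry a factor B^(1/2), so the defect is
    B^(1/2) applied to the slab error of A~. *)
Lemma dual_defect s : s <= t -> nr (B (dual1 s) - A (dual s)) <= k * (e * nr phi).
Proof.
move=> st.
have -> : B (dual1 s) - A (dual s) = - Bh (At (slab_sum (weight s)) - slab_sum (weight1 s)).
  rewrite (linB _ _ Bh_lin) /At /= BmhK /dual1 /dual -BhBh BmhK.
  by rewrite opprB.
rewrite nrN; apply: le_trans (Bh_bound _) _; rewrite ler_wpM2l //.
rewrite -[e]mulr1; apply: At_slab_sum_approx => // j; exact: weight_le1.
Qed.

Variables (h h1 h2 : R -> H) (L L' : R -> R) (C M : R).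
Hypotheses (hs : classical_solution dot A B h h1 h2) (C_ge0 : 0 <= C) (M_gt0 : 0 < M).
Hypotheses (h_le : forall s, 0 <= s -> nr (h s) <= C * M)
  (h1_le : forall s, 0 <= s -> s * nr (h1 s) <= C * M)
  (L_der : forall s, 0 <= s -> rder L s (L' s))
  (L'_le : forall s, 0 <= s -> L' s <= - (2 * c) * s ^+ 3 * nr (h2 s) ^+ 2)
  (L_le : forall s, 0 <= s -> 0 <= L s <= C * M ^+ 2).

Lemma early_pairing : ip (B (h (t / 2)) + h1 (t / 2)) (dual (t / 2)) - ip (h (t / 2)) (dual1 (t / 2))
  - (ip (B (h 0) + h1 0) (dual 0) - ip (h 0) (dual1 0)) <= 9 * k * C * M * t^-1 * nr phi.
Proof.
have t2 : 0 <= t / 2 by rewrite divr_ge0 // ltW.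
have p0 := nr_ge0 phi.
pose F s := ip (B (h s) + h1 s) (dual s) + -1 * ip (h s) (dual1 s).
pose F' s := ip (B (h1 s) + h2 s) (dual s) + ip (B (h s) + h1 s) (dual1 s)
  + -1 * (ip (h1 s) (dual1 s) + ip (h s) (dual2 s)).
have dF s : 0 <= s -> rder F s (F' s).
  move=> s0; have [_ _ _ [d0 d1 _ _ _]] := hs s0.
  apply: rderD; last apply: rder_scale; apply: rder_ip => //.
  - by apply: hderD => //; exact: (hder_lin B_lin B_bound).
  - exact: dual_hder.
  - exact: dual1_hder.
(* 17 = 1 + 16: the slab defect, and 4 (2/t)^2 from y'' with t - s >= t/2. Integration over [0, t/2]
   halves it, and 9 rounds up. *)
have bF s : 0 <= s <= t / 2 -> F' s <= 17 * k * C * M * (t^-1 * t^-1) * nr phi.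
  move=> /andP[s0 st]; have [Ah Ah1 e2 _] := hs s0.
  have slt : s < t by move: st t_gt0; lra.
  have -> : F' s = ip (h s) (B (dual1 s) - A (dual s)) - ip (h s) (dual2 s).
    rewrite /F' e2 !ipE (A_sym Ah (dual_dom s)) (B_sym (h s)); ring.
  have hM := h_le s0; have CM : 0 <= C * M by rewrite mulr_ge0 // ltW.
  have T1 : ip (h s) (B (dual1 s) - A (dual s)) <= C * M * (k * (e * nr phi)).
    by apply: le_trans (ip_le hH _ _) _; rewrite ler_pM ?nr_ge0 // dual_defect // ltW.
  have T2 : - ip (h s) (dual2 s) <= C * M * (k * (4 * (2 * t^-1 * (2 * t^-1)) * nr phi)).
    rewrite -ipNl; apply: le_trans (ip_le hH _ _) _; rewrite nrN ler_pM ?nr_ge0 //.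
    apply: le_trans (dual2_le slt) _; rewrite ler_wpM2l // ler_wpM2r // ler_wpM2l //.
    have ts : (t - s)^-1 <= 2 * t^-1.
      rewrite -[2]invrK -invfM lef_pV2 ?posrE ?mulr_gt0 ?invr_gt0 ?subr_gt0 //.
      by rewrite mulrC; lra.
    by rewrite ler_pM // invr_ge0 subr_ge0 ltW.
  apply: le_trans (lerD T1 T2) _; rewrite eE le_eqVlt; apply/orP; left; apply/eqP; ring.
have := rder_mvt_le (lexx 0) t2 (fun s (s01 : 0 <= s <= t / 2) => dF s (andP s01).1) bF.
rewrite /F !mulN1r subr0 => /le_trans; apply.
have -> : 17 * k * C * M * (t^-1 * t^-1) * nr phi * (t / 2) =
  (17 / 2) * (k * C * M * t^-1 * nr phi) by field; rewrite gt_eqF.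
have -> : 9 * k * C * M * t^-1 * nr phi = 9 * (k * C * M * t^-1 * nr phi) by ring.
by rewrite ler_wpM2r ?mulr_ge0 ?(ltW M_gt0) ?(ltW tV_gt0) //; lra.
Qed.

(* h2 is square integrable with weight s^3, which the Lyapunov function measures: *)
(* the two weights in the AM-GM inequality are balanced by [kap]. *)
Lemma late_pairing : 0 < nr phi ->
  ip (B (h t)) (dual t) - ip (B (h (t / 2))) (dual (t / 2)) <=
  (C + k ^+ 2 / (2 * c) + k * C) * M * t^-1 * nr phi.
Proof.
move=> p0; have t2 : 0 <= t / 2 by rewrite divr_ge0 // ltW.
have tt : t / 2 <= t by move: t_gt0; lra.
pose kap := nr phi / (t * M); have kap0 : 0 < kap by rewrite divr_gt0 // mulr_gt0.
pose F s := ip (B (h s)) (dual s) + kap * L s.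
pose F' s := ip (B (h1 s)) (dual s) + ip (B (h s)) (dual1 s) + kap * L' s.
have dF s : 0 <= s -> rder F s (F' s).
  move=> s0; have [_ _ _ [d0 _ _ _ _]] := hs s0.
  apply: rderD; last by apply: rder_scale; exact: L_der.
  apply: rder_ip => //; last exact: dual_hder.
  exact: (hder_lin B_lin B_bound).
(* Put w = c kap t^3. On [t/2, t] the term kap L' is at most - (w/4) |h''|^2, which cancels one side
   of AM-GM for |h''| k |phi| and leaves k^2 |phi|^2 / w. The second term is the slab defect. *)
pose Q := k ^+ 2 * nr phi ^+ 2 / (c * kap * t ^+ 3) + C * M * (k * (e * nr phi)).
have bF s : t / 2 <= s <= t -> F' s <= Q.
  move=> /andP[ts st]; have s0 := le_trans t2 ts; have [Ah Ah1 e2 _] := hs s0.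
  have -> : F' s = - ip (h2 s) (dual s) + ip (h s) (B (dual1 s) - A (dual s)) + kap * L' s.
    rewrite /F' e2 !ipE (A_sym Ah (dual_dom s)) (B_sym (h s)); ring.
  have hM := h_le s0.
  have T1 : ip (h s) (B (dual1 s) - A (dual s)) <= C * M * (k * (e * nr phi)).
    by apply: le_trans (ip_le hH _ _) _; rewrite ler_pM ?nr_ge0 // dual_defect.
  have T2 : - ip (h2 s) (dual s) <= nr (h2 s) * (k * nr phi).
    rewrite -ipNl; apply: le_trans (ip_le hH _ _) _; rewrite nrN ler_wpM2l ?nr_ge0 //.
    exact: dual_le.
  have T3 : kap * L' s <= kap * (- (2 * c) * (t / 2) ^+ 3 * nr (h2 s) ^+ 2).
    rewrite ler_wpM2l ?(ltW kap0) //; apply: le_trans (L'_le s0) _.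
    have st3 : (t / 2) ^+ 3 * nr (h2 s) ^+ 2 <= s ^+ 3 * nr (h2 s) ^+ 2.
      by rewrite ler_wpM2r ?sqr_ge0 // lerXn2r ?nnegrE.
    have := ler_wpM2l (ltW c_gt0) st3.
    by move: ((t / 2) ^+ 3) (s ^+ 3) (nr (h2 s) ^+ 2) => x y z; lra.
  have w0 : 0 < c * kap * t ^+ 3 by apply: mulr_gt0; [exact: mulr_gt0|exact: exprn_gt0].
  have T4 : nr (h2 s) * (k * nr phi) <= c * kap * t ^+ 3 / 4 * nr (h2 s) ^+ 2 +
      k ^+ 2 * nr phi ^+ 2 / (c * kap * t ^+ 3).
    move: (nr (h2 s)) => x; set w := c * kap * t ^+ 3 in w0 *.
    have := sqr_ge0 (w / 2 * x - k * nr phi) => sq.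
    rewrite -(ler_pM2l w0).
    have -> : w * (w / 4 * x ^+ 2 + k ^+ 2 * nr phi ^+ 2 / w) =
      w ^+ 2 / 4 * x ^+ 2 + k ^+ 2 * nr phi ^+ 2 by field; rewrite gt_eqF.
    by move: sq; lra.
  by rewrite /Q; move: T1 T2 T3 T4; lra.
have := rder_mvt_le t2 tt (fun s (s01 : t / 2 <= s <= t) => dF s (le_trans t2 (andP s01).1)) bF.
have /andP[Lt _] := L_le (ltW t_gt0); have /andP[_ Lt2] := L_le t2.
rewrite /F => hF.
have kL : kap * L (t / 2) <= C * M * t^-1 * nr phi.
  apply: le_trans (ler_wpM2l (ltW kap0) Lt2) _; rewrite le_eqVlt; apply/orP; left.
  by apply/eqP; rewrite /kap; field; rewrite !gt_eqF.
have kL0 : 0 <= kap * L t by rewrite mulr_ge0 // ltW.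
have QE : Q * (t - t / 2) = k ^+ 2 / (2 * c) * M * t^-1 * nr phi + k * C / 2 * M * t^-1 * nr phi.
  by rewrite /Q /kap eE; field; rewrite !gt_eqF.
have kC : 0 <= k * C / 2 * M * t^-1 * nr phi.
  by rewrite !mulr_ge0 ?invr_ge0 ?(ltW M_gt0) ?(ltW tV_gt0) ?(ltW t_gt0) ?nr_ge0.
rewrite QE in hF.
have -> : (C + k ^+ 2 / (2 * c) + k * C) * M * t^-1 * nr phi =
  C * M * t^-1 * nr phi + k ^+ 2 / (2 * c) * M * t^-1 * nr phi
  + 2 * (k * C / 2 * M * t^-1 * nr phi) by field; rewrite !gt_eqF.
by move: hF kL kL0 kC; lra.
Qed.

(** Adding the two halves cancels the pairings of B h at t/2. The other boundary terms are O(1/t):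
    at t/2 by decay of h' and of y', at 0 by decay of y'. The count is 15 = 9 + 1 + 2 + 2 + 1. *)
Lemma heat_duality : ip (Bh (h t)) phi <= ip (Bmh (B (h 0) + h1 0)) (slab_sum (weight 0))
  + (C + k ^+ 2 / (2 * c) + 15 * k * C) * M * t^-1 * nr phi.
Proof.
(* Treated apart because the balancing weight of the late pairing would vanish. *)
have [p0|p0] := eqVneq (nr phi) 0.
  have s0 : slab_sum (weight 0) = 0.
    apply/nr_eq0/eqP; rewrite eq_le nr_ge0 andbT.
    have := slab_sum_bound ler01 (fun j => weight_le1 j (ltW t_gt0)).
    by rewrite p0 mulr0.
  by rewrite s0 (nr_eq0 p0) !ip0r nr0 mulr0 addr0.
have pp : 0 < nr phi by rewrite lt_neqAle eq_sym p0 nr_ge0.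
have X0 : 0 <= M * t^-1 * nr phi by rewrite !mulr_ge0 ?(ltW M_gt0) ?(ltW tV_gt0) ?nr_ge0.
have t2 : 0 <= t / 2 by rewrite divr_ge0 // ltW.
have Bmh_sym u w : ip (Bmh u) w = ip u (Bmh w).
  by rewrite -{1}(BmhK w) -Bh_sym BmhK.
have e1 : ip (Bh (h t)) phi = ip (B (h t)) (dual t).
  rewrite -BhBh -(Bmh_sym (Bh (Bh (h t)))) BhK; congr (ip _ (slab_sum _)).
  by apply/funext => j; rewrite /weight subrr mul0r oppr0 expR0.
have e2 : ip (Bmh (B (h 0) + h1 0)) (slab_sum (weight 0)) = ip (B (h 0) + h1 0) (dual 0).
  exact: Bmh_sym.
have lt2 : t / 2 < t by move: t_gt0; lra.
have tE : (t - t / 2)^-1 = 2 * t^-1 by field; rewrite gt_eqF.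
have hM := h_le t2; have h0M := h_le (lexx 0).
have T1 : ip (h (t / 2)) (dual1 (t / 2)) <= C * M * (k * (2 * t^-1 * nr phi)).
  by apply: le_trans (ip_le hH _ _) _; rewrite ler_pM ?nr_ge0 // -tE dual1_le.
have T2 : - ip (h1 (t / 2)) (dual (t / 2)) <= 2 * t^-1 * (C * M) * (k * nr phi).
  rewrite -ipNl; apply: le_trans (ip_le hH _ _) _; rewrite nrN ler_pM ?nr_ge0 //.
    have := h1_le t2 => hh; rewrite -(ler_pM2l (_ : 0 < t / 2)) ?divr_gt0 //.
    apply: le_trans hh _; rewrite le_eqVlt; apply/orP; left; apply/eqP.
    by field; rewrite gt_eqF.
  by apply: dual_le; exact: ltW.
have T3 : - ip (h 0) (dual1 0) <= C * M * (k * (t^-1 * nr phi)).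
  rewrite -ipNl; apply: le_trans (ip_le hH _ _) _; rewrite nrN ler_pM ?nr_ge0 //.
  by have := dual1_le t_gt0; rewrite subr0.
have := early_pairing; have := late_pairing pp.
rewrite e1 e2 !(ipDl dot (B (h (t / 2)))).
have -> : (C + k ^+ 2 / (2 * c) + k * C) * M / t * nr phi =
  (C + k ^+ 2 / (2 * c) + k * C) * (M * t^-1 * nr phi) by ring.
have -> : 9 * k * C * M / t * nr phi = 9 * k * C * (M * t^-1 * nr phi) by ring.
have -> : (C + k ^+ 2 / (2 * c) + 15 * k * C) * M / t * nr phi =
  (C + k ^+ 2 / (2 * c) + 15 * k * C) * (M * t^-1 * nr phi) by ring.
have E1 : C * M * (k * (2 * t^-1 * nr phi)) = 2 * (k * C) * (M * t^-1 * nr phi) by ring.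
have E2 : 2 * t^-1 * (C * M) * (k * nr phi) = 2 * (k * C) * (M * t^-1 * nr phi) by ring.
have E3 : C * M * (k * (t^-1 * nr phi)) = k * C * (M * t^-1 * nr phi) by ring.
rewrite E1 in T1; rewrite E2 in T2; rewrite E3 in T3.
have kC : 0 <= k * C * (M * t^-1 * nr phi) by apply: mulr_ge0 => //; exact: mulr_ge0.
move: (M * t^-1 * nr phi) (k ^+ 2 / (2 * c)) X0 T1 T2 T3 kC => X Y X0 T1 T2 T3 kC U1 U2.
by lra.
Qed.

Hypotheses (heat_sym : forall u w, ip (heat u) w = ip u (heat w))
  (Bh_dom : forall u, dom A u -> dom A (Bh u)).
Hypothesis h2_le : t ^+ 3 * nr (h2 t) ^+ 2 <= C * M ^+ 2.

(** Here d is 2 a - b, and x is the vector B^(1/2) u0 + B^(-1/2) u1 to which the heat flow is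
    applied. *)
Lemma error_pairing (x d : H) : dom A d -> nr d <= 2 * M -> nr x <= M ->
  x = Bmh (B (h 0) + h1 0 + A d) ->
  ip (Bh (h t - 2%:C *: h1 t + h2 t) - heat x) phi <=
  (C + k ^+ 2 / (2 * c) + 15 * k * C + 2 * k * C + k * (C + 1) + 1 + 4 * k) * M * t^-1 * nr phi.
Proof.
move=> Ad dM xM xE; have p0 := nr_ge0 phi; have M0 := ltW M_gt0; have tV0 := ltW tV_gt0.
have Bmh_sym u w : ip (Bmh u) w = ip u (Bmh w).
  by rewrite -{1}(BmhK w) -Bh_sym BmhK.
set G0 := slab_sum (weight 0).
have G_dom : dom A G0 := (At_slab_sum (weight 0)).1.
have T1 := heat_duality.
have h1M : nr (h1 t) <= C * M * t^-1.
  by rewrite ler_pdivlMr // mulrC; apply: h1_le; exact: ltW.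
(* From t^2 <= t^3 for t > 1; C + 1 appears because C <= (C + 1)^2. *)
have h2M : nr (h2 t) <= (C + 1) * M * t^-1.
  rewrite ler_pdivlMr // -ler_sqr ?nnegrE ?mulr_ge0 ?nr_ge0 ?(ltW t_gt0) ?addr_ge0 //.
  apply: (@le_trans _ _ (t ^+ 3 * nr (h2 t) ^+ 2)).
    rewrite exprMn mulrC ler_wpM2r ?sqr_ge0 //.
    by rewrite [t ^+ 3]exprS ler_peMl ?sqr_ge0 // ltW.
  apply: le_trans h2_le _; rewrite exprMn ler_wpM2r ?sqr_ge0 //.
  by have := C_ge0; nra.
have T2 : - ip (Bh (h1 t)) phi <= k * (C * M * t^-1) * nr phi.
  rewrite -ipNl; apply: le_trans (ip_le hH _ _) _; rewrite nrN ler_wpM2r //.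
  by apply: le_trans (Bh_bound _) _; rewrite ler_wpM2l.
have T3 : ip (Bh (h2 t)) phi <= k * ((C + 1) * M * t^-1) * nr phi.
  apply: le_trans (ip_le hH _ _) _; rewrite ler_wpM2r //.
  by apply: le_trans (Bh_bound _) _; rewrite ler_wpM2l.
have T4 : - ip x (heat phi - G0) <= M * (t^-1 * nr phi).
  rewrite -ipNl; apply: le_trans (ip_le hH _ _) _; rewrite nrN ler_pM ?nr_ge0 //.
  exact: heat_slab_sum.
have AtG : nr (At G0) <= 2 * t^-1 * nr phi.
  rewrite -[At G0](subrK (slab_sum (weight1 0))) (le_trans (nrD _ _)) //.
  have u1 := At_slab_sum_approx ler01 (fun j => weight_le1 j (ltW t_gt0)).
  have u2 : nr (slab_sum (weight1 0)) <= t^-1 * nr phi.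
    by apply: slab_sum_bound => // j; have := weight1_le j t_gt0; rewrite subr0.
  have et : e <= t^-1.
    by rewrite eE ler_piMr // invf_le1 // ltW.
  have u3 := ler_wpM2r p0 et; rewrite mulr1 in u1.
  by apply: le_trans (lerD u1 u2) _; lra.
have T5 : - ip (Bmh (A d)) G0 <= k * (2 * M) * (2 * t^-1 * nr phi).
  (* Moving A from d, where only |d| is bounded, onto the heat flow gains 1/t. *)
  have -> : ip (Bmh (A d)) G0 = ip (Bh d) (At G0).
    by rewrite Bmh_sym (A_sym Ad (Bmh_dom G_dom)) (Bh_sym d) /At /= BmhK.
  rewrite -ipNl; apply: le_trans (ip_le hH _ _) _; rewrite nrN ler_pM ?nr_ge0 //.
  by apply: le_trans (Bh_bound _) _; rewrite ler_wpM2l.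
have -> : ip (Bh (h t - 2%:C *: h1 t + h2 t) - heat x) phi =
   ip (Bh (h t)) phi + 2 * (- ip (Bh (h1 t)) phi) + ip (Bh (h2 t)) phi
   - ip x (heat phi - G0) - ip x G0.
  rewrite (linD _ _ Bh_lin) (linB _ _ Bh_lin) (linZ _ _ Bh_lin) !ipE heat_sym; ring.
have -> : ip x G0 = ip (Bmh (B (h 0) + h1 0)) G0 + ip (Bmh (A d)) G0.
  by rewrite xE (linD _ _ Bmh_lin) ipDl.
move: T1 T2 T3 T4 T5; rewrite -/G0.
move: (k ^+ 2 / (2 * c)) => q T1 T2 T3 T4 T5.
have -> : (C + q + 15 * k * C + 2 * k * C + k * (C + 1) + 1 + 4 * k) * M * t^-1 * nr phi =
  (C + q + 15 * k * C) * M * t^-1 * nr phi + 2 * (k * (C * M * t^-1) * nr phi)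
  + k * ((C + 1) * M * t^-1) * nr phi + M * (t^-1 * nr phi) + k * (2 * M) * (2 * t^-1 * nr phi).
  by ring.
by move: T1 T2 T3 T4 T5; lra.
Qed.

End HeatDuality.

(** * Smooth data and the final estimate *)

(** It is enough to test W against its own partial slab sums s, since (W, s) tends to |W|^2 and |s|
    to |W|. *)
Lemma nr_le_exhaustion (R : realType) (H : completeNormedModType R[i])
    (dot : {dot H for Num.conj}) (P : nat -> H -> H) (W : H) (D : R) :
  hilbert_norm dot -> 0 <= D ->
  (forall u, \sum_(0 <= j < n) P j u @[n --> \oo] --> u) ->
  (forall n, re_dot dot W (\sum_(0 <= j < n) P j W) <= D * nr (\sum_(0 <= j < n) P j W)) ->
  nr W <= D.
Proof.
move=> hH D0 PT h; have [W0|W0] := eqVneq (nr W) 0; first by rewrite W0.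
have Wp : 0 < nr W by rewrite lt_neqAle eq_sym W0 nr_ge0.
rewrite -(ler_pM2r Wp) -expr2 -(ipxx hH).
apply: (@ler_addMgt0 _ _ _ (D + nr W)) => [|e e0]; first by rewrite addr_ge0 ?nr_ge0.
have /cvg_nr/(_ e e0) [N _ /(_ N (leqnn N)) /= /ltW hN] := PT W.
have := h N; move: hN; set s := \sum_(0 <= j < N) _ => hN hs.
have h1 : nr s <= nr W + e.
  by rewrite -[s](subrK W) addrC (le_trans (nrD _ _)) // lerD2l.
have h2 : re_dot dot W (W - s) <= nr W * e.
  by apply: le_trans (ip_le hH _ _) _; rewrite ler_wpM2l ?nr_ge0 // nrBC.
have := ler_wpM2l D0 h1; move: h2; rewrite !ipE; lra.
Qed.

(** * Smoothing the data by the resolvent *)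

Section Resolvent.
Variables (R : realType) (H : completeNormedModType R[i]).
Variable dot : {dot H for Num.conj}.
Hypothesis hH : hilbert_norm dot.
Local Notation ip := (re_dot dot).
Variables (A : operator H) (B : H -> H) (k : R).
Hypotheses (A_sa : self_adjoint dot A) (A_ge0 : forall u, dom A u -> 0 <= ip (A u) u).
Hypotheses (B_lin : linear B) (k_ge0 : 0 <= k) (B_bound : forall u, nr (B u) <= k * nr u)
  (B_sym : forall u v, ip (B u) v = ip u (B v)) (B_ge0 : forall u, 0 <= ip (B u) u).

(* For g = u1 + u0 + B u0, the pair (p, p - u0) is (1 - G)^-1 (u0, u1). *)
Lemma wave_resolvent (g : H) : exists p, [/\ dom A p, A p = g - p - B p & nr p <= nr g].
Proof.
pose T u := u + B u.
have T_lin : linear T.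
  by move=> a u v; rewrite /T B_lin scalerDr addrACA.
have T_low u : nr u ^+ 2 <= ip (T u) u by rewrite /T ipDl (ipxx hH) lerDl.
have [||p Ap pE] := @coercive_surjective _ _ dot hH A T (1 + k) g A_sa A_ge0 T_lin _ _ T_low.
- move=> u; rewrite mulrDl mul1r (le_trans (nrD _ _)) // lerD2l; exact: B_bound.
- by move=> u v; rewrite /T ipDl ipDr B_sym.
exists p; split => //; first by rewrite -pE -addrA -opprD addrK.
rewrite -pE; apply: (coercive_nr_le hH) => //; exact: A_ge0.
Qed.

Lemma smooth_data (u0 u1 : H) : exists a b e : H,
  [/\ dom A a /\ dom A b, e = - A a - B b,
      a - 2%:C *: b + e = u0 /\ b - 2%:C *: e + (- A b - B e) = u1,
      B u0 + u1 = B a + b + A (2%:C *: a - b) &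
      forall m, nr u0 + nr u1 <= m -> let M := 8 * (1 + k) ^+ 3 * m in
      [/\ nr a <= M, nr b <= M, nr e <= M,
          ip (A a) a <= M ^+ 2 /\ ip (A b) b <= M ^+ 2 & nr (2%:C *: a - b) <= 2 * M]].
Proof.
have [p [Ap pE pg]] := wave_resolvent (u1 + u0 + B u0).
have [a [Aa aE ag]] := wave_resolvent (p - u0 + p + B p).
pose b := a - p; pose q := p - u0; pose e := b - q.
have [lA _ _] := A_sa; have [Ab AbE] := operatorB lA Aa Ap; rewrite -/b in Ab AbE.
have BB u v : B (u - v) = B u - B v by exact: linB.
have eE : e = - A a - B b.
  rewrite aE /e /q /b BB; apply: (ip_ext hH) => w; rewrite !ipE; ring.
exists a, b, e; split => //.
- split; first by rewrite /e /q /b; apply: (ip_ext hH) => w; rewrite !ipE; ring.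
  rewrite AbE pE aE /e /q /b !BB; apply: (ip_ext hH) => w; rewrite !ipE; ring.
- have [A2a A2aE] := operatorZi 2%:C lA Aa; have [_ ->] := operatorB lA A2a Ab.
  rewrite A2aE AbE pE aE /b; apply: (ip_ext hH) => w; rewrite !ipE; ring.
(* Each resolvent costs a factor D and reading off A a one more: p, a, A a and A b are bounded by D
   m, 3 D^2 m, 6 D^3 m and 8 D^3 m, hence the constant in M. *)
move=> m m0 M; pose D := 1 + k.
have D1 : 1 <= D by rewrite lerDl.
have m00 : 0 <= m by apply: le_trans m0; rewrite addr_ge0 ?nr_ge0.
have u0m : nr u0 <= m by apply: le_trans m0; rewrite lerDl nr_ge0.
have D0 : 0 <= D by lra.
have Bn x z : nr x <= z -> nr (B x) <= k * z.
  by move=> xz; apply: le_trans (B_bound x) _; rewrite ler_wpM2l.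
have pm : nr p <= D * m.
  apply: le_trans pg _; have := Bn _ _ u0m.
  have := nrD (u1 + u0) (B u0); have := nrD u1 u0; rewrite /D; lra.
have qm : nr q <= 2 * (D * m).
  have : m <= D * m by rewrite ler_peMl.
  by have := nrB p u0; rewrite /q; lra.
have am : nr a <= 3 * (D ^+ 2 * m).
  apply: le_trans ag _; have := Bn _ _ pm; have := nrD (p - u0 + p) (B p).
  have : D * m <= D ^+ 2 * m by rewrite expr2 -mulrA ler_peMl // mulr_ge0.
  have -> : k * (D * m) = D ^+ 2 * m - D * m by rewrite /D; ring.
  by have := nrD (p - u0) p; rewrite -/q; lra.
have DD2 : D * m <= D ^+ 2 * m by rewrite expr2 -mulrA ler_peMl // mulr_ge0.
have DD3 : D ^+ 2 * m <= D ^+ 3 * m by rewrite [D ^+ 3]exprS -mulrA ler_peMl // mulr_ge0 // sqr_ge0.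
have X0 : 0 <= D ^+ 2 * m by rewrite mulr_ge0 // sqr_ge0.
have bm : nr b <= 4 * (D ^+ 2 * m) by have := nrB a p; rewrite /b; lra.
have em : nr e <= 6 * (D ^+ 2 * m) by have := nrB b q; rewrite /e; lra.
have Aam : nr (A a) <= 6 * (D ^+ 3 * m).
  rewrite aE; have := Bn _ _ am; have := nrB (p - u0 + p + B p - a) (B a).
  have := nrB (p - u0 + p + B p) a; have := nrD (p - u0 + p) (B p); have := nrD (p - u0) p.
  have := Bn _ _ pm; rewrite -/q.
  have -> : k * (D * m) = D ^+ 2 * m - D * m by rewrite /D; ring.
  have -> : k * (3 * (D ^+ 2 * m)) = 3 * (D ^+ 3 * m) - 3 * (D ^+ 2 * m) by rewrite /D; ring.
  by lra.
have Apm : nr (A p) <= 2 * (D ^+ 2 * m).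
  rewrite pE; have := Bn _ _ pm; have := Bn _ _ u0m.
  have := nrB (u1 + u0 + B u0 - p) (B p); have := nrB (u1 + u0 + B u0) p.
  have := nrD (u1 + u0) (B u0); have := nrD u1 u0.
  have -> : k * (D * m) = D ^+ 2 * m - D * m by rewrite /D; ring.
  have -> : k * m = D * m - m by rewrite /D; ring.
  by lra.
have Abm : nr (A b) <= 8 * (D ^+ 3 * m) by rewrite AbE; have := nrB (A a) (A p); lra.
have ME : M = 8 * (D ^+ 3 * m) by rewrite /M /D; ring.
clearbody M; subst M; set X := D ^+ 3 * m in DD3 Aam Abm *.
have sq x y : nr x <= 8 * X -> nr y <= 8 * X -> ip x y <= (8 * X) ^+ 2.
  by move=> hx hy; apply: le_trans (ip_le hH _ _) _; rewrite expr2 ler_pM ?nr_ge0.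
split; [lra|lra|lra|split; apply: sq; lra|].
have := nrB (2%:C *: a) b; rewrite nrZ ger0_norm //; lra.
Qed.

End Resolvent.

Lemma sandwich_pos (R : realType) (H : completeNormedModType R[i])
    (dot : {dot H for Num.conj}) (A : operator H) (T T' : H -> H) u :
  positive dot A -> linear_operator A -> cancel T T' -> linear T' ->
  (forall u v, re_dot dot (T u) v = re_dot dot u (T v)) -> (forall v, dom A v -> dom A (T v)) ->
  dom A u -> re_dot dot (sandwich T A u) u <= 0 -> u = 0.
Proof.
move=> pA lA TK lT' sT dT Au h; rewrite -[u]TK.
suff -> : T u = 0 by exact: lin0.
by apply: (positive_inj pA (dT u Au)); rewrite -sT.
Qed.

(* sqA, Bh and Bmh are A^(1/2), B^(1/2) and B^(-1/2); heat t is exp(-t A~). *)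
Theorem theorem1p1 (R : realType)
  (H : completeNormedModType R[i]) (dot : {dot H for Num.conj})
  (hH : hilbert_norm dot)
  (A : operator H) (A_sa : self_adjoint dot A) (A_pos : positive dot A)
  (B : H -> H) (B_bounded : bounded_operator B)
  (B_sa : self_adjoint dot (everywhere B))
  (c : R) (c_gt0 : 0 < c)
  (B_ge : forall u : H, c%:C * dot u u <= dot (B u) u)
  (sqA : operator H) (hsqA : is_sqrt dot A sqA)
  (Bh Bmh : H -> H) (hBh : is_sqrt dot (everywhere B) (everywhere Bh))
  (BhK : cancel Bh Bmh) (BmhK : cancel Bmh Bh)
  (Bh_dom : continuous_on_domain A Bh) (Bmh_dom : continuous_on_domain A Bmh)
  (heat : R -> H -> H)
  (hheat : forall t : R, 0 <= t ->
     functional_calculus dot (sandwich Bmh A) (fun x : R => expR (- t * x))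
       (everywhere (heat t)))
  (H1 : completeNormedModType R[i]) (dot1 : {dot H1 for Num.conj})
  (hH1 : hilbert_norm dot1)
  (j : H -> H1) (hj : energy_completion A sqA j)
  (U : R -> H1 * H -> H1 * H) (hU : contraction_semigroup U)
  (U_gen : has_generator U (damped_wave_graph dot dot1 A sqA B j)) :
  exists2 C : R, 0 < C &
    forall (u0 u1 : H) (u : R -> H) (t : R),
      dom sqA u0 -> is_solution sqA j U u0 u1 u -> 1 < t ->
      `|u t - Bmh (heat t (Bh u0)) - Bmh (heat t (Bmh u1))|
        <= C%:C * (t^-1)%:C * (`|u0| + `|sqA u0| + `|u1|).
Proof.
have [A_lin A_dense _] := A_sa.
have A_sym u v : dom A u -> dom A v -> re_dot dot (A u) v = re_dot dot u (A v).
  exact: self_adjoint_sym.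
have A_ge0 u : dom A u -> 0 <= re_dot dot (A u) u by move=> Au; exact: positive_ip.
have [B_lin [K0 hK0]] := B_bounded.
have B_sym u v := everywhere_sym u v B_sa.
have [Bh_sa _ _ BhE] := hBh.
have Bh_sym u v := everywhere_sym u v Bh_sa.
have BhBh u : Bh (Bh u) = B u by exact: (esym (BhE u I)).
have Bh_lin : linear Bh.
  by move=> a u v; have [[_ /(_ a u v I I)[]]] := Bh_sa.
have Bmh_lin : linear Bmh.
  by move=> a u v; apply: (can_inj BhK); rewrite Bh_lin !BmhK.
have Bmh_sym u v : re_dot dot (Bmh u) v = re_dot dot u (Bmh v).
  by rewrite -{1}(BmhK v) -Bh_sym BmhK.
have Bh_dom' u : dom A u -> dom A (Bh u) by case: Bh_dom => ? _ h /h[].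
have Bmh_dom' u : dom A u -> dom A (Bmh u) by case: Bmh_dom => ? _ h /h[].
have B_low u : c * nr u ^+ 2 <= re_dot dot (B u) u.
  have := B_ge u; rewrite (dot_xx hH) -rmorphM lecE => /andP[_].
  by rewrite /re_dot.
have B_ge0 u : 0 <= re_dot dot (B u) u.
  by apply: le_trans (B_low u); rewrite mulr_ge0 ?sqr_ge0 // ltW.
pose K := `|K0|; have K_ge0 : 0 <= K by exact: normr_ge0.
have B_bound u : nr (B u) <= K * nr u.
  have : nr (B u) <= K0 * nr u by rewrite -lecR rmorphM /= -!nrE; exact: hK0.
  by move/le_trans; apply; rewrite ler_wpM2r ?nr_ge0 // ler_norm.
(* One constant for B, B^(1/2) and B^(-1/2), whose squared norms are at most K^2, K and 1/c; having
   k >= 1 allows K <= k^2 and 1/c <= k^2. *)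
pose k := 1 + K + c^-1.
have cV0 : 0 < c^-1 by rewrite invr_gt0.
have k_ge1 : 1 <= k by rewrite /k -addrA lerDl addr_ge0 // ltW.
have k_ge0 : 0 <= k by apply: le_trans k_ge1.
have Kk : K <= k by rewrite /k; lra.
have B_boundk u : nr (B u) <= k * nr u.
  by apply: le_trans (B_bound u) _; rewrite ler_wpM2r ?nr_ge0.
have Bh_bound u : nr (Bh u) <= k * nr u.
  rewrite -ler_sqr ?nnegrE ?mulr_ge0 ?nr_ge0 // -(ipxx hH) Bh_sym BhBh ipC.
  apply: le_trans (ip_le hH _ _) _; rewrite expr2 ler_pM ?nr_ge0 //.
  by rewrite ler_peMl ?nr_ge0.
have Bmh_bound u : nr (Bmh u) <= k * nr u.
  rewrite -ler_sqr ?nnegrE ?mulr_ge0 ?nr_ge0 //.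
  have := B_low (Bmh u); rewrite -BhBh BmhK Bh_sym BmhK (ipxx hH) => h.
  apply: (@le_trans _ _ (c^-1 * nr u ^+ 2)); first by rewrite ler_pdivlMl.
  rewrite exprMn ler_wpM2r ?sqr_ge0 // expr2.
  by apply: (@le_trans _ _ k); [rewrite /k; lra|rewrite ler_peMl].
have [C0 C00 decay] := classical_decay hH c_gt0 K_ge0 B_lin B_bound B_sym B_low A_ge0.
pose D := C0 + k ^+ 2 / (2 * c) + 15 * k * C0 + 2 * k * C0 + k * (C0 + 1) + 1 + 4 * k.
have D0 : 0 < D.
  have C0p := ltW C00.
  have : 0 <= k ^+ 2 / (2 * c) by rewrite divr_ge0 ?sqr_ge0 // mulr_ge0 // ltW.
  have kC : 0 <= k * C0 by rewrite mulr_ge0.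
  by rewrite /D; move: (k ^+ 2 / (2 * c)) => q; lra.
pose Q := 8 * (1 + k) ^+ 3.
have k1 : 0 < 1 + k by rewrite ltr_pwDl.
have Q0 : 0 < Q by rewrite mulr_gt0 // exprn_gt0.
exists (k * D * Q) => [|u0 u1 u t Su0 hu t1].
  by rewrite !mulr_gt0 // (lt_le_trans ltr01).
have t0 : 0 < t by apply: lt_trans t1.
have main m : 0 < m -> nr u0 + nr u1 <= m ->
    nr (u t - Bmh (heat t (Bh u0)) - Bmh (heat t (Bmh u1))) <= k * D * Q * t^-1 * m.
  move=> m0 um.
  have [a [b [e [[Aa Ab] eE [u0E u1E] xE /(_ m um)]]]] :=
    smooth_data hH A_sa A_ge0 B_lin k_ge0 B_boundk B_sym B_ge0 u0 u1.
  rewrite /= -/Q; set M := Q * m => -[aM bM eM [AaM AbM] dM].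
  have M0 : 0 < M by rewrite mulr_gt0.
  (* The regularity of u0 enters here: e differs from u0 by elements of D(A), so G (a, b) lies in
     the domain of G. *)
  have Se : dom sqA e.
    have lS := sqrt_linear hsqA.
    have [S1 _] := operator_lin 2 lS Su0 (dom_sqrt hsqA Ab).
    have [S2 _] := operatorB lS S1 (dom_sqrt hsqA Aa).
    suff -> : e = u0 + 2%:C *: b - a by [].
    by rewrite -u0E; apply: (ip_ext hH) => w; rewrite !ipE; ring.
  rewrite -u0E -u1E in hu.
  have [h [h1 [h2 [h0 h10 h20 hs uE]]]] :=
    classical_solution_ex hH hH1 A_sa A_pos hsqA hj hU U_gen Aa Ab Se eE hu.
  have [|||||L [L' hL]] := decay h h1 h2 M hs (ltW M0); rewrite ?h0 ?h10 ?h20 //.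
  have e0 : 0 < t^-1 * t^-1 by rewrite mulr_gt0 ?invr_gt0.
  have At_pos v : dom (sandwich Bmh A) v -> re_dot dot (sandwich Bmh A v) v <= 0 -> v = 0.
    exact: (sandwich_pos A_pos A_lin BmhK Bh_lin Bmh_sym Bmh_dom').
  have [P [P1 P2 P3 P4 [heat_lin [heat_sym P5]]]] :=
    spectral_steps hH t0 e0 (A_dense : dense (dom (sandwich Bmh A))) At_pos (hheat t (ltW t0)).
  pose x := Bh u0 + Bmh u1.
  have xE' : x = Bmh (B (h 0) + h1 0 + A (2%:C *: a - b)).
    by rewrite h0 h10 -xE (linD _ _ Bmh_lin) -BhBh BhK.
  have xM : nr x <= M.
    have h3 := nrD (Bh u0) (Bmh u1); have h4 := Bh_bound u0; have h5 := Bmh_bound u1.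
    have : k * (nr u0 + nr u1) <= k * m by rewrite ler_wpM2l.
    have : k * m <= Q * m.
      rewrite ler_wpM2r ?(ltW m0) // /Q; have := k_ge0; nra.
    by rewrite /M /x; lra.
  (* The error is multiplied by B^(1/2) because (B^(1/2) h(t), phi) = (B h(t), B^(-1/2) phi) is the
     pairing at time t that duality controls. *)
  pose W := Bh (u t) - heat t x.
  have WE : u t - Bmh (heat t (Bh u0)) - Bmh (heat t (Bmh u1)) = Bmh W.
    by rewrite /W (linB _ _ Bmh_lin) BhK /x (linD _ _ heat_lin) (linD _ _ Bmh_lin) opprD addrA.
  rewrite WE; apply: le_trans (Bmh_bound W) _.
  suff : nr W <= D * M * t^-1.
    by move/(ler_wpM2l k_ge0)/le_trans; apply; rewrite le_eqVlt; apply/orP; left; apply/eqP; rewrite /M; ring.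
  apply: (nr_le_exhaustion hH _ P5).
    by rewrite !mulr_ge0 ?invr_ge0 ?ltW.
  move=> n.
  have -> : \sum_(0 <= j < n) P j W = slab_sum P W n (fun=> 1).
    by apply: eq_bigr => i _; rewrite rmorph1 scale1r.
  have [_ _ _ [_ _ h2t]] := hL t (ltW t0).
  have Ad : dom A (2%:C *: a - b).
    have [A2a _] := operatorZi 2%:C A_lin Aa; exact: (operatorB A_lin A2a Ab).1.
  have WE2 : W = Bh (h t - 2%:C *: h1 t + h2 t) - heat t x by rewrite /W uE // ltW.
  rewrite [X in re_dot dot X _]WE2.
  have P_dom i v : dom A (P i v) by have [] := P1 i v.
  have P_idem i v : P i (P i v) = P i v by have [] := P1 i v.
  have P_At i v : P i (sandwich Bmh A (P i v)) = sandwich Bmh A (P i v) by have [] := P1 i v.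
  have P_heat i v : P i (heat t (P i v)) = heat t (P i v) by have [] := P1 i v.
  have h_le s : 0 <= s -> nr (h s) <= C0 * M by move=> /hL[_ _ _ []].
  have h1_le s : 0 <= s -> s * nr (h1 s) <= C0 * M by move=> /hL[_ _ _ []].
  have L_der s : 0 <= s -> rder L s (L' s) by move=> /hL[].
  have L'_le s : 0 <= s -> L' s <= - (2 * c) * s ^+ 3 * nr (h2 s) ^+ 2 by move=> /hL[].
  have L_le s : 0 <= s -> 0 <= L s <= C0 * M ^+ 2 by move=> /hL[].
  exact: (error_pairing hH A_lin A_sym B_lin Bh_lin Bmh_lin heat_lin k_ge0 c_gt0 B_boundk
    Bh_bound Bmh_bound BhBh BhK BmhK B_sym Bh_sym Bmh_dom' t1 erefl P_dom P_idem P_At P_heat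
    P2 P3 (fun i v => (P4 i v).1) (fun i v => (P4 i v).2) W n hs (ltW C00) M0 h_le h1_le
    L_der L'_le L_le heat_sym h2t Ad dM xM xE').
rewrite !nrE -!rmorphD -!rmorphM lecR.
(* The bound [main] requires m > 0, since M is a divisor in the duality argument; m is taken as the
   norm of the data plus an arbitrary e > 0, which covers zero data. *)
apply: (@ler_addMgt0 _ _ _ (k * D * Q * t^-1)) => [|e e0].
  by rewrite ltW // divr_gt0 // mulr_gt0 // mulr_gt0 // (lt_le_trans ltr01).
have S0 := nr_ge0 (sqA u0).
rewrite [e * _]mulrC -mulrDr.
apply: main; first by rewrite ltr_wpDl // !addr_ge0 ?nr_ge0.
by have := ltW e0; lra.
Qed.
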